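(* Assume (A). If $d = \tilde{\omega}\big(\max(n^{3/2}p,\,n)\big)$, then $$\mathsf{TV}\Big(\mathsf{RGG}(n,\mathbb{T}^d,\mathsf{Unif},\sigma^\infty_p,p),\ \mathsf{G}(n,p)\Big) = o(1)\quad\text{as } n\to\infty.$$
   Context: Torus: $\mathbb{T}^d=\mathbb{R}^d/2\mathbb{Z}^d$, i.e. a product of $d$ circles of circumference $2$, with the uniform (Haar) probability measure $\mathsf{Unif}$. For $x,y$ on a circle of circumference 2, $|x-y|_C\in[0,1]$ is the circular distance (length of the shorter arc). For $1\le q<\infty$, $\|\mathbf{x}-\mathbf{y}\|_q=(\sum_{i=1}^d|x_i-y_i|_C^q)^{1/q}$, and $\|\mathbf{x}-\mathbf{y}\|_\infty=\max_i|x_i-y_i|_C$. For $p\in[0,1]$ and $q\in[1,\infty]$, $\tau^q_p$ is the value with $\mathbf{P}_{\mathbf{x},\mathbf{y}\text{ iid }\mathsf{Unif}}[\|\mathbf{x}-\mathbf{y}\|_q\le\tau^q_p]=p$, and $\sigma^q_p(\mathbf{x},\mathbf{y})=\mathbb{1}[\|\mathbf{x}-\mathbf{y}\|_q\le\tau^q_p]$. The random geometric graph $\mathsf{RGG}(n,\mathbb{T}^d,\mathsf{Unif},\sigma^q_p,p)$ on vertex set $[n]$: sample $\mathbf{x}^1,\dots,\mathbf{x}^n$ iid uniform on $\mathbb{T}^d$ and join $i,j$ iff $\|\mathbf{x}^i-\mathbf{x}^j\|_q\le\tau^q_p$. $\mathsf{G}(n,p)$ is the Erdős–Rényi graph. Assumption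 (A): there are absolute constants $\delta,\epsilon>0$ with $n^{-1+\epsilon}\le p\le 1/2$ and $n^\delta\le d$. The notations $\tilde o,\tilde\omega,\tilde O$ hide polylogarithmic factors in $n$. *)

(* Defs.v *)
From HB Require Import structures.
From mathcomp Require Import all_boot all_order all_algebra.
From mathcomp Require Import all_classical all_reals all_analysis.
Set Implicit Arguments. Unset Strict Implicit. Unset Printing Implicit Defensive.
Import Order.TTheory GRing.Theory Num.Theory.
Import numFieldNormedType.Exports.
Local Open Scope ring_scope.

Section RGGDefs.
Variable R : realType.

(* Uniform (Haar) probability on the torus R^I/2Z^I for a finite coordinate
   set I, realized on the fundamental domain [0,2)^I as an iterated integral
   of the normalized Lebesgue measure (1/2) dt on [0,2), one coordinate at a
   time (by Fubini-Tonelli this is the product probability measure for the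
   nonnegative measurable integrands used below). *)
Fixpoint iint (I : eqType) (s : seq I) (f : (I -> R) -> \bar R) : \bar R :=
  match s with
  | [::] => f (fun _ => 0)
  | i :: s' =>
      ((2^-1)%:E *
       \int[@lebesgue_measure R]_(t in `[0%R, 2%R[%classic)
          iint s' (fun x => f (fun j => if j == i then t else x j)))%E
  end.

Definition unif_prob (I : finType) (P : (I -> R) -> bool) : R :=
  fine (iint (enum I) (fun z => ((P z)%:R)%:E)).

(* circular distance on a circle of circumference 2, for representatives in [0,2) *)
Definition circd (x y : R) : R := Num.min `|x - y| (2 - `|x - y|).

Definition linf (d : nat) (x y : 'I_d -> R) : R :=
  \big[Num.max/0]_(k < d) circd (x k) (y k).

Definition edge_prob (d : nat) (tau : R) : R :=
  unif_prob (fun z : bool * 'I_d -> R =>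
    linf (fun k => z (false, k)) (fun k => z (true, k)) <= tau).

(* Graphs on vertex set [n] = 'I_n, given by their edge set (a set of 2-subsets). *)
Definition graph_on (n : nat) := {set {set 'I_n}}.

Definition rgg_graph (n d : nat) (tau : R) (z : 'I_n * 'I_d -> R) : graph_on n :=
  [set e : {set 'I_n} | [exists i : 'I_n, exists j : 'I_n,
     [&& (i < j)%N, e == [set i; j]%SET &
         linf (fun k => z (i, k)) (fun k => z (j, k)) <= tau]]].

Definition rgg_law (n d : nat) (tau : R) (E : graph_on n) : R :=
  unif_prob (fun z : 'I_n * 'I_d -> R => rgg_graph tau z == E).

Definition er_law (n : nat) (p : R) (E : graph_on n) : R :=
  if E \subset [set e : {set 'I_n} | #|e| == 2%N]
  then p ^+ #|E| * (1 - p) ^+ ('C(n, 2) - #|E|)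
  else 0.

Definition tv_rgg_er (n d : nat) (p tau : R) : R :=
  2^-1 * \sum_(E : graph_on n) `|rgg_law d tau E - er_law p E|.

End RGGDefs.

(* Main.v *)
Require Import Defs.
From HB Require Import structures.
From mathcomp Require Import all_boot all_order all_algebra.
From mathcomp Require Import all_classical all_reals all_analysis.
From mathcomp Require Import ring lra.
From mathcomp Require Import measurable_realfun.
Import Order.TTheory GRing.Theory Num.Theory.
Import numFieldNormedType.Exports.
Set Implicit Arguments. Unset Strict Implicit. Unset Printing Implicit Defensive.
Local Open Scope classical_set_scope.
Local Open Scope ring_scope.

(** Reveal the vertices one at a time.  By the chain rule, the relative entropy of the
    geometric graph with respect to G(n,p) grows, when vertex k is added, by at most the
    chi-square divergence of the k-th row of the adjacency matrix from k independent
    Bernoulli(p) variables, averaged over the positions of the earlier vertices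
    (Cauchy-Schwarz removes the conditioning on the graph seen so far).  Expanding the
    square with an independent copy of the new vertex and integrating out the k earlier
    vertices, this averaged divergence equals [E (1 + g)^k - 1], where [g] is the normalised
    covariance, given two points x and y, of their adjacencies to a common uniform point.

    Write [lam = 1 - tau], so [p = (1 - lam)^d] and [lam <= ln n / d].  Since the metric is a
    maximum, [g] is an affine function of [prod_c (1 - 2 lam + m_c)], where [m_c] in
    [[0, lam]] is the probability that a uniform point is far from both x_c and y_c, and
    [E m_c = lam^2].  As [E g = 0], a second-order expansion bounds the divergence by
    [O (k^2 p^2 (ln n)^4 / d^2)]; summing over k gives an entropy of order
    [(n^(3/2) p (ln n)^2 / d)^2], while [d >> n (ln n)^2] controls the exponential moment in
    the remainder.  A Pinsker-type inequality concludes, with C = 2. *)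

(** * Averaging over coordinates *)

Section CoordinateAveraging.
Context (R : realType) (dX : measure_display) (X : measurableType dX).
Variables (I : eqType) (P : probability X R).
Implicit Types (f g : (I -> X) -> R) (z : I -> X) (s : seq I).

Definition upd z (i : I) (t : X) : I -> X := fun j => if j == i then t else z j.

Lemma upd_comm z i j t u : i != j -> upd (upd z i t) j u = upd (upd z j u) i t.
Proof.
move=> ij; apply/funext => k; rewrite /upd.
by case: eqVneq => [->|//]; rewrite eq_sym (negbTE ij).
Qed.

Lemma upd_id z i t u : upd (upd z i t) i u = upd z i u.
Proof. by apply/funext => k; rewrite /upd; case: eqVneq. Qed.

(* Measurability for the product sigma-algebra on [I -> X], tested along all measurable
   families of coordinates, so that this sigma-algebra need not be constructed. *)
Definition meas_fun f := forall (d : measure_display) (T : measurableType d)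
  (g : I -> T -> X), (forall i, measurable_fun setT (g i)) ->
  measurable_fun setT (fun t => f (fun i => g i t)).

Definition mbf f := meas_fun f /\ exists M : R, forall z, `|f z| <= M.

(** A partial average remains a function of the whole point, so averages over different coordinates
    compose freely without splitting the product space. *)
Definition avg (i : I) f : (I -> X) -> R := fun z => \int[P]_t f (upd z i t).

Definition indep (i : I) f := forall z t, f (upd z i t) = f z.

Lemma mbf_cst (c : R) : mbf (fun=> c).
Proof. by split; [move=> *; exact: measurable_cst|exists `|c|]. Qed.

Lemma mbfD f g : mbf f -> mbf g -> mbf (fun z => f z + g z).
Proof.
move=> [mf [M bf]] [mg [N bg]]; split.
  by move=> d T h mh; apply: measurable_funD; [exact: mf|exact: mg].
by exists (M + N) => z; rewrite (le_trans (ler_normD _ _))// lerD.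
Qed.

Lemma mbfM f g : mbf f -> mbf g -> mbf (fun z => f z * g z).
Proof.
move=> [mf [M bf]] [mg [N bg]]; split.
  by move=> d T h mh; apply: measurable_funM; [exact: mf|exact: mg].
by exists (M * N) => z; rewrite normrM ler_pM.
Qed.

Lemma mbfZ (c : R) f : mbf f -> mbf (fun z => c * f z).
Proof. by move=> ?; apply: mbfM => //; exact: mbf_cst. Qed.

Lemma mbf_sum (J : Type) (r : seq J) (Q : pred J) (F : J -> (I -> X) -> R) :
  (forall j, mbf (F j)) -> mbf (fun z => \sum_(j <- r | Q j) F j z).
Proof.
move=> mF; elim: r => [|j r ih].
  rewrite (_ : (fun z => _) = fun=> 0); first exact: mbf_cst.
  by apply/funext => z; rewrite big_nil.
rewrite (_ : (fun z => _) = fun z => if Q j then F j z + \sum_(j <- r | Q j) F j z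
    else \sum_(j <- r | Q j) F j z); last by apply/funext => z; rewrite big_cons.
by case: (Q j) => //; exact: mbfD.
Qed.

Lemma mbf_prod (J : Type) (r : seq J) (Q : pred J) (F : J -> (I -> X) -> R) :
  (forall j, mbf (F j)) -> mbf (fun z => \prod_(j <- r | Q j) F j z).
Proof.
move=> mF; elim: r => [|j r ih].
  rewrite (_ : (fun z => _) = fun=> 1); first exact: mbf_cst.
  by apply/funext => z; rewrite big_nil.
rewrite (_ : (fun z => _) = fun z => if Q j then F j z * \prod_(j <- r | Q j) F j z
    else \prod_(j <- r | Q j) F j z); last by apply/funext => z; rewrite big_cons.
by case: (Q j) => //; exact: mbfM.
Qed.

Lemma mbf_exp k f : mbf f -> mbf (fun z => f z ^+ k).
Proof.
move=> mf; elim: k => [|k ih]; first exact: mbf_cst.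
rewrite (_ : (fun z => _) = fun z => f z * f z ^+ k); first exact: mbfM.
by apply/funext => z; rewrite exprS.
Qed.

Lemma measurable_upd_pair (d : measure_display) (T : measurableType d)
    (g : I -> T -> X) (mg : forall i, measurable_fun setT (g i)) i j :
  measurable_fun setT (fun tu : T * X => upd (fun k => g k tu.1) i tu.2 j).
Proof.
rewrite /upd; case: eqVneq => _; first exact: measurable_snd.
by apply: measurableT_comp => //; exact: measurable_fst.
Qed.

Lemma measurable_upd z i j : measurable_fun setT (fun t => upd z i t j).
Proof. by rewrite /upd; case: eqVneq => _ //; exact: measurable_cst. Qed.

Lemma integrable_upd f z i : mbf f ->
  P.-integrable setT (EFin \o (fun t => f (upd z i t))).
Proof.
move=> [mf [M bf]].
apply: measurable_bounded_integrable => //.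
- by rewrite (le_lt_trans (probability_le1 _ _))// ltry.
- by apply: (mf _ _ (fun j t => upd z i t j)) => j; exact: measurable_upd.
- by exists M; split; [exact: num_real|move=> x Mx t _; apply: le_trans (bf _) (ltW Mx)].
Qed.

Lemma avgE f z i : mbf f ->
  (avg i f z)%:E = (\int[P]_t (f (upd z i t))%:E)%E.
Proof.
move=> mf; rewrite /avg /Rintegral fineK//.
exact: (integrable_fin_num _ (integrable_upd _ _ mf)).
Qed.

Lemma avg_cst (c : R) i : avg i (fun=> c) = fun=> c.
Proof.
apply/funext => z; rewrite /avg Rintegral_cst//.
by rewrite [X in fine X]probability_setT mulr1.
Qed.

Lemma avgD f g i : mbf f -> mbf g ->
  avg i (fun z => f z + g z) = fun z => avg i f z + avg i g z.
Proof.
by move=> mf mg; apply/funext => z; rewrite /avg RintegralD//; exact: integrable_upd.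
Qed.

Lemma avgM_indep f g i : indep i f -> mbf g ->
  avg i (fun z => f z * g z) = fun z => f z * avg i g z.
Proof.
move=> fi mg; apply/funext => z; rewrite /avg.
under eq_Rintegral do rewrite fi.
by rewrite RintegralZl//; exact: integrable_upd.
Qed.

Lemma avgZ (c : R) f i : mbf f -> avg i (fun z => c * f z) = fun z => c * avg i f z.
Proof. by move=> mf; rewrite (@avgM_indep (fun=> c)). Qed.

Lemma avg_le f g i : mbf f -> mbf g -> (forall z, f z <= g z) ->
  forall z, avg i f z <= avg i g z.
Proof. by move=> mf mg fg z; apply: le_Rintegral => //; exact: integrable_upd. Qed.

Lemma indep_avg f i : indep i (avg i f).
Proof. by move=> z t; rewrite /avg; under eq_Rintegral do rewrite upd_id. Qed.

Lemma indep_avg_other f i j : indep j f -> indep j (avg i f).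
Proof.
have [->|ij] := eqVneq i j; first by move=> _; exact: indep_avg.
have ji : j != i by rewrite eq_sym.
move=> fj z t; rewrite /avg.
under eq_Rintegral do rewrite (upd_comm _ _ _ ji) fj.
by [].
Qed.

Lemma mbf_avg f i : mbf f -> mbf (avg i f).
Proof.
move=> mbff; have [mf [M bf]] := mbff; split; last first.
  have bfM z : - M <= f z <= M by rewrite -ler_norml.
  exists M => z; rewrite ler_norml; apply/andP; split.
  - have := @avg_le (fun=> - M) f i (mbf_cst _) mbff; rewrite avg_cst; apply.
    by move=> z'; have /andP[] := bfM z'.
  - have := @avg_le f (fun=> M) i mbff (mbf_cst _); rewrite avg_cst; apply.
    by move=> z'; have /andP[] := bfM z'.
move=> d T g mg.
(* Shifting by [M] reduces to the nonnegative case of Tonelli. *)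
pose h (tu : T * X) := (f (upd (fun k => g k tu.1) i tu.2) + M)%:E.
have mh : measurable_fun setT h.
  apply/measurable_EFinP; apply: measurable_funD => //.
  by apply: (mf _ _ (fun j (tu : T * X) => upd (fun k => g k tu.1) i tu.2 j)) => j;
    exact: measurable_upd_pair.
have h0 tu : (0 <= h tu)%E.
  by rewrite lee_fin; have := bf (upd (fun k => g k tu.1) i tu.2);
    rewrite ler_norml => /andP[]; lra.
have := @measurable_fun_fubini_tonelli_F _ _ _ _ _ P h mh h0.
rewrite /fubini_F => mF.
have -> : (fun t => avg i f (fun k => g k t)) =
    (fun t => fine (\int[P]_y h (t, y))%E - M).
  apply/funext => t; rewrite /h/=.
  rewrite -(avgE (f := fun z => f z + M)) /=; last by apply: mbfD => //; exact: mbf_cst.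
  by rewrite avgD//; [rewrite avg_cst addrK|exact: mbf_cst].
apply: measurable_funB => //.
exact: measurableT_comp.
Qed.

Lemma avg_comm f i j : mbf f -> avg i (avg j f) = avg j (avg i f).
Proof.
move=> mbff; have [->//|ij] := eqVneq i j.
have [mf [M bf]] := mbff.
(* Adding the bound [M] makes the function nonnegative, where Tonelli applies; constants average to
   themselves, so the shift cancels. *)
suff h f' : mbf f' -> (forall z, 0 <= f' z) -> avg i (avg j f') = avg j (avg i f').
  have mM := mbf_cst M; have mfM := mbfD mbff mM.
  have := h (fun z => f z + M) mfM.
  have f0 : forall z, 0 <= f z + M.
    by move=> z; have := bf z; rewrite ler_norml => /andP[]; lra.
  rewrite !avgD ?avg_cst//; do ?exact: mbf_avg.
  by move=> /(_ f0) E; apply/funext => z; move/(congr1 (fun g => g z)): E => /addIr.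
move=> mbf' f'0; have [mf' _] := mbf'.
apply/funext => z; apply: EFin_inj; rewrite !avgE; do ?exact: mbf_avg.
under eq_integral do rewrite avgE//.
under [RHS]eq_integral do rewrite avgE//.
rewrite (@fubini_tonelli _ _ _ _ _ P P (fun tu => (f' (upd (upd z i tu.1) j tu.2))%:E)).
- by apply: eq_integral => t _; apply: eq_integral => u _; rewrite /= upd_comm.
- apply/measurable_EFinP.
  apply: (mf' _ _ (fun k (tu : X * X) => upd (upd z i tu.1) j tu.2 k)) => k.
  apply: (@measurable_upd_pair _ _ (fun k t => upd z i t k)) => k'.
  exact: measurable_upd.
- by move=> tu; rewrite lee_fin.
Qed.

Definition avgs s f := foldr avg f s.

Lemma avgs_cat s1 s2 f : avgs (s1 ++ s2) f = avgs s1 (avgs s2 f).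
Proof. exact: foldr_cat. Qed.

Lemma mbf_avgs s f : mbf f -> mbf (avgs s f).
Proof. by move=> mf; elim: s => //= i s; exact: mbf_avg. Qed.

Lemma avgs_cst s (c : R) : avgs s (fun=> c) = fun=> c.
Proof. by elim: s => //= i s ->; exact: avg_cst. Qed.

Lemma avgsD s f g : mbf f -> mbf g ->
  avgs s (fun z => f z + g z) = fun z => avgs s f z + avgs s g z.
Proof. by move=> mf mg; elim: s => //= i s ->; rewrite avgD//; exact: mbf_avgs. Qed.

Lemma avgsZ s (c : R) f : mbf f -> avgs s (fun z => c * f z) = fun z => c * avgs s f z.
Proof. by move=> mf; elim: s => //= i s ->; rewrite avgZ//; exact: mbf_avgs. Qed.

Lemma avgs_sum s (J : Type) (r : seq J) (F : J -> (I -> X) -> R) :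
  (forall j, mbf (F j)) ->
  avgs s (fun z => \sum_(j <- r) F j z) = fun z => \sum_(j <- r) avgs s (F j) z.
Proof.
move=> mF; elim: r => [|j r ih].
  rewrite (_ : (fun z => _) = fun=> 0); last by apply/funext => z; rewrite big_nil.
  by rewrite avgs_cst; apply/funext => z; rewrite big_nil.
rewrite (_ : (fun z => _) = fun z => F j z + \sum_(j <- r) F j z); last first.
  by apply/funext => z; rewrite big_cons.
rewrite avgsD//; last exact: mbf_sum.
by apply/funext => z; rewrite big_cons ih.
Qed.

Lemma avgs_le s f g : mbf f -> mbf g -> (forall z, f z <= g z) ->
  forall z, avgs s f z <= avgs s g z.
Proof.
by move=> mf mg fg; elim: s => //= i s ih z; apply: avg_le => //; exact: mbf_avgs.
Qed.

Lemma avgs_ge0 s f : mbf f -> (forall z, 0 <= f z) -> forall z, 0 <= avgs s f z.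
Proof.
by move=> mf f0; have := @avgs_le s (fun=> 0) f (mbf_cst _) mf f0; rewrite avgs_cst.
Qed.

Lemma avgsM_indep s f g : {in s, forall i, indep i f} -> mbf g ->
  avgs s (fun z => f z * g z) = fun z => f z * avgs s g z.
Proof.
move=> fi mg; elim: s fi => //= i s ih fi.
rewrite ih; last by move=> j js; apply: fi; rewrite inE js orbT.
by rewrite avgM_indep//; [apply: fi; rewrite mem_head|exact: mbf_avgs].
Qed.

Lemma indep_avgs s f j : indep j f -> indep j (avgs s f).
Proof. by move=> fj; elim: s => //= i s; exact: indep_avg_other. Qed.

Lemma avgs_avg_comm s i f : mbf f -> avgs s (avg i f) = avg i (avgs s f).
Proof. by move=> mf; elim: s => //= j s ->; rewrite avg_comm//; exact: mbf_avgs. Qed.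

Lemma avgs_comm s1 s2 f : mbf f -> avgs s1 (avgs s2 f) = avgs s2 (avgs s1 f).
Proof.
by move=> mf; elim: s1 => //= i s1 ->; rewrite avgs_avg_comm//; exact: mbf_avgs.
Qed.

Lemma avgs_perm s1 s2 f : mbf f -> perm_eq s1 s2 -> avgs s1 f = avgs s2 f.
Proof.
move=> mf; elim: s1 s2 => [|i s1 ih] s2.
  by move/perm_size/esym/size0nil => ->.
move=> p12; have /path.splitPr is2 : i \in s2 by rewrite -(perm_mem p12) mem_head.
case: is2 p12 => s3 s4 p12.
rewrite avgs_cat -[avgs (i :: s4) f]/(avg i (avgs s4 f)) avgs_avg_comm; last exact: mbf_avgs.
rewrite -avgs_cat -[LHS]/(avg i (avgs s1 f)) (ih (s3 ++ s4))//.
by rewrite -(perm_cons i) (perm_trans p12)// perm_catC /= perm_cons perm_catC.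
Qed.

(** Induction on [s]: each integrated coordinate is set to a common value on both sides, so it can
    be added to [D] for the rest of the list. *)
Lemma avgs_depends s f (D : pred I) :
  (forall z z', (forall i, D i || (i \in s) -> z i = z' i) -> f z = f z') ->
  forall z z', (forall i, D i -> z i = z' i) -> avgs s f z = avgs s f z'.
Proof.
elim: s D => [|i s ih] D fD z z' zz' /=.
  by apply: fD => j; rewrite orbF; exact: zz'.
rewrite /avg; apply: eq_Rintegral => t _; apply: (ih (fun j => D j || (j == i))).
  by move=> z1 z2 z12; apply: fD => j; rewrite inE orbA; exact: z12.
by move=> j; rewrite /upd; case: eqP => //= _; rewrite orbF; exact: zz'.
Qed.

Lemma indep_prod (J : eqType) (r : seq J) (F : J -> (I -> X) -> R) i :
  {in r, forall j, indep i (F j)} -> indep i (fun z => \prod_(j <- r) F j z).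
Proof. by move=> Fi z t; apply: eq_big_seq => j jr; exact: Fi. Qed.

(** Independence of the coordinates: among those in [s], the factor [F i] sees only [i], so each
    average passes through all other factors. *)
Lemma avgs_prod s (F : I -> (I -> X) -> R) : uniq s -> (forall i, mbf (F i)) ->
  {in s &, forall i j, i != j -> indep i (F j)} ->
  avgs s (fun z => \prod_(i <- s) F i z) = fun z => \prod_(i <- s) avg i (F i) z.
Proof.
move=> us mF; elim: s us => [_ _|i s ih /= /andP[nis us] Fi].
  by apply/funext => z; rewrite big_nil /= big_nil.
rewrite (_ : (fun z => _) = fun z => F i z * \prod_(j <- s) F j z); last first.
  by apply/funext => z; rewrite big_cons.
rewrite avgsM_indep; last exact: mbf_prod.
  rewrite ih// => [|j k js ks]; last by apply: Fi; rewrite inE ?js ?ks orbT.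
  have -> : (fun z => F i z * \prod_(j <- s) avg j (F j) z) =
      (fun z => \prod_(j <- s) avg j (F j) z * F i z).
    by apply/funext => z; rewrite mulrC.
  rewrite avgM_indep//.
    by apply/funext => z; rewrite big_cons mulrC.
  apply: indep_prod => j js; apply: indep_avg_other.
  by apply: Fi; rewrite ?mem_head// ?inE ?js ?orbT//; apply: contraNneq nis => ->.
move=> j js; apply: Fi; rewrite ?mem_head// ?inE ?js ?orbT//.
by apply: contraNneq nis => <-.
Qed.

End CoordinateAveraging.

Arguments mbf_cst {R dX X I} c.

(** * Renaming and freezing coordinates *)

Section Transport.
Context (R : realType) (dX : measure_display) (X : measurableType dX).
Variable (P : probability X R).

Lemma upd_comp_inj (I I' : eqType) (phi : I -> I') (z : I' -> X) i t :
  injective phi -> upd z (phi i) t \o phi = upd (z \o phi) i t.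
Proof. by move=> phi_inj; apply/funext => j; rewrite /upd /= (inj_eq phi_inj). Qed.

Lemma avgs_map (I I' : eqType) (phi : I -> I') (s : seq I) (f : (I -> X) -> R) :
  injective phi ->
  avgs P (map phi s) (fun z => f (z \o phi)) = fun z => avgs P s f (z \o phi).
Proof.
move=> phi_inj; elim: s => //= i s ->; apply/funext => z; rewrite /avg.
by apply: eq_Rintegral => t _; rewrite upd_comp_inj.
Qed.

Lemma mbf_upd (I : eqType) (f : (I -> X) -> R) i t : mbf f -> mbf (fun z => f (upd z i t)).
Proof.
move=> [mf [M bf]]; split; last by exists M.
move=> d T g mg; apply: (mf _ _ (fun j u => upd (fun k => g k u) i t j)) => j.
by rewrite /upd; case: eqVneq => _ //; exact: measurable_cst.
Qed.

Lemma avgs_upd (I : eqType) (s : seq I) (f : (I -> X) -> R) i t z : i \notin s ->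
  avgs P s (fun z => f (upd z i t)) z = avgs P s f (upd z i t).
Proof.
elim: s z => //= j s ih z; rewrite inE negb_or => /andP[ij nis]; rewrite /avg.
apply: eq_Rintegral => u _; rewrite -[LHS]/(avgs P s _ _) ih//.
by rewrite upd_comm// eq_sym.
Qed.

End Transport.

(** * The uniform circle and its distance kernel *)

Section UniformCircle.
Variable R : realType.

Let lt02 : (0 : R) < 2. Proof. exact: ltr0n. Qed.

Definition circle_prob : probability (measurableTypeR R) R := uniform_prob lt02.

Lemma integral_circle_prob (f : measurableTypeR R -> R) :
  measurable_fun setT f -> (forall t, 0 <= f t) ->
  ((2^-1)%:E * \int[@lebesgue_measure R]_(t in `[0%R, 2%R[%classic) (f t)%:E =
   \int[circle_prob]_t (f t)%:E)%E.
Proof.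
move=> mf f0; rewrite integral_uniform//; last first.
  exact/measurable_EFinP.
rewrite subr0 integral_itv_bndo_bndc//.
by apply/measurable_EFinP; exact: measurable_funTS.
Qed.

(** The two sides substitute coordinates in opposite orders; for distinct coordinates the orders
    agree by [avgs_upd]. The base point 0 is the one from which [iint] starts. *)
Lemma iint_avgs (I : eqType) (s : seq I) (f : (I -> measurableTypeR R) -> R) :
  uniq s -> mbf f -> (forall z, 0 <= f z) ->
  iint s (fun z => (f z)%:E) = (avgs circle_prob s f (fun=> 0))%:E.
Proof.
elim: s f => //= i s ih f /andP[nis us] mf f0.
rewrite avgE; last exact: mbf_avgs.
rewrite -integral_circle_prob.
- congr (_ * _)%E; apply: eq_integral => t _.
  rewrite (ih (fun z => f (upd z i t)))//; last exact: mbf_upd.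
  by rewrite avgs_upd.
- have [m _] := mbf_avgs circle_prob s mf.
  apply: (m _ (measurableTypeR R) (fun j t => upd ((fun=> 0) : I -> measurableTypeR R) i t j)) => j.
  exact: measurable_upd.
- by move=> t; exact: avgs_ge0.
Qed.

Lemma eq_iint (I : eqType) (s : seq I) (f g : (I -> R) -> \bar R) :
  (forall z, (forall i, 0 <= z i < 2) -> f z = g z) -> iint s f = iint s g.
Proof.
elim: s f g => [|i s ih] f g fg /=; first by apply: fg => _; rewrite lexx ltr0n.
congr (_ * _)%E; apply: eq_integral => t; rewrite inE /= in_itv /= => t02.
by apply: ih => z z02; apply: fg => j; case: eqP.
Qed.

Lemma iint_map (I I' : eqType) (phi : I -> I') (s : seq I) (f : (I -> R) -> \bar R) :
  injective phi -> iint (map phi s) (fun z => f (z \o phi)) = iint s f.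
Proof.
move=> phi_inj; elim: s f => //= i s ih f.
congr (_ * _)%E; apply: eq_integral => t _.
rewrite -(ih (fun x => f (fun j => if j == i then t else x j))); congr iint.
by apply/funext => z; congr f; apply/funext => j /=; rewrite (inj_eq phi_inj).
Qed.

(** The bridge from [unif_prob] to averages: coordinates may be renamed by [phi] and reordered, and
    the event need only be matched on the fundamental domain. *)
Lemma unif_prob_avgs (I : finType) (I' : eqType) (phi : I -> I')
    (s : seq I') (Q : (I' -> measurableTypeR R) -> bool) (Q0 : (I -> R) -> bool) :
  injective phi -> perm_eq s (map phi (enum I)) ->
  mbf (fun z => (Q z)%:R : R) ->
  (forall z : I' -> R, (forall i, 0 <= z i < 2) -> Q0 (z \o phi) = Q z) ->
  unif_prob Q0 = avgs circle_prob s (fun z => (Q z)%:R) (fun=> 0).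
Proof.
move=> phi_inj ps mQ QQ0.
rewrite /unif_prob -(iint_map _ _ phi_inj).
rewrite (@eq_iint _ _ _ (fun z => ((Q z)%:R)%:E)) => [|z z02]; last by rewrite QQ0.
rewrite (iint_avgs (f := fun z => (Q z)%:R))//; last by rewrite map_inj_uniq ?enum_uniq.
exact: (esym (congr1 (fun f => f (fun=> 0)) (avgs_perm circle_prob mQ ps))).
Qed.

(* Representatives outside the fundamental domain are sent to 0, so that the marginals of
   [circle_close] below are constant on all of R. *)
Definition circle_rep (x : R) : R := if 0 <= x < 2 then x else 0.

Definition circle_close (tau x y : R) : bool := circd (circle_rep x) (circle_rep y) <= tau.

Lemma circdC (x y : R) : circd x y = circd y x.
Proof. by rewrite /circd distrC. Qed.

Lemma circle_closeC tau x y : circle_close tau x y = circle_close tau y x.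
Proof. by rewrite /circle_close circdC. Qed.

Lemma circle_rep_id x : 0 <= x < 2 -> circle_rep x = x.
Proof. by rewrite /circle_rep => ->. Qed.

Lemma circle_repP x : 0 <= circle_rep x < 2.
Proof. by rewrite /circle_rep; case: ifP => //; rewrite lexx ltr0n. Qed.

Lemma measurable_circle_rep : measurable_fun setT circle_rep.
Proof.
apply: measurable_fun_ifT => //.
by apply: measurable_and; [exact: measurable_fun_ler|exact: measurable_fun_ltr].
Qed.

Lemma measurable_circle_close tau (d : measure_display) (T : measurableType d)
    (f g : T -> measurableTypeR R) :
  measurable_fun setT f -> measurable_fun setT g ->
  measurable_fun setT (fun t => (circle_close tau (f t) (g t))%:R : R).
Proof.
move=> mf mg.
have -> : (fun t => (circle_close tau (f t) (g t))%:R : R) =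
    (fun t => if circle_close tau (f t) (g t) then 1 else 0).
  by apply/funext => t; case: circle_close.
apply: measurable_fun_ifT => //; apply: measurable_fun_ler => //.
have mrf : measurable_fun setT (circle_rep \o f).
  by apply: measurableT_comp => //; exact: measurable_circle_rep.
have mrg : measurable_fun setT (circle_rep \o g).
  by apply: measurableT_comp => //; exact: measurable_circle_rep.
by apply: measurable_minr; [|apply: measurable_funB => //];
  apply: measurableT_comp => //; exact: measurable_funB.
Qed.

(** The far points form the arc opposite [x]. It lies to the right of [x], to the left of [x], or is
    cut in two by the point where 0 and 2 are glued; the length is the same in all three cases. *)
Lemma lebesgue_far (tau x : R) : 0 <= tau <= 1 -> 0 <= x < 2 ->
  lebesgue_measure (`[0, 2[ `&` [set t | tau < circd x t]) = (2 - 2 * tau)%:E.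
Proof.
move=> /andP[t0 t1] /andP[x0 x2].
have E t : (tau < circd x t) = (tau < `|x - t| < 2 - tau).
  by rewrite /circd lt_min; congr (_ && _); rewrite ltrBrDl -ltrBrDr.
have itvE (a b : R) : lebesgue_measure `]a, b[%classic = (Num.max 0 (b - a))%:E.
  rewrite lebesgue_measure_itv /= lte_fin; case: ltP => ab.
    by rewrite -EFinD; congr EFin; rewrite max_r//; lra.
  by congr EFin; rewrite max_l//; lra.
have itvE' (a b : R) : lebesgue_measure `[a, b[%classic = (Num.max 0 (b - a))%:E.
  rewrite lebesgue_measure_itv /= lte_fin; case: ltP => ab.
    by rewrite -EFinD; congr EFin; rewrite max_r//; lra.
  by congr EFin; rewrite max_l//; lra.
have [xt|tx] := leP x tau.
  rewrite (_ : _ `&` _ = `]x + tau, x + 2 - tau[%classic); last first.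
    apply/seteqP; split => t /=; rewrite !in_itv /= E; case: (lerP t x) => h.
    - by move=> [/andP[? ?] /andP[? ?]]; apply/andP; split; lra.
    - by move=> [/andP[? ?] /andP[? ?]]; apply/andP; split; lra.
    - by move=> /andP[? ?]; split; apply/andP; split; lra.
    - by move=> /andP[? ?]; split; apply/andP; split; lra.
  by rewrite itvE; congr EFin; rewrite max_r; lra.
have [xt|xt] := leP 2 (x + tau).
  rewrite (_ : _ `&` _ = `]x - 2 + tau, x - tau[%classic); last first.
    apply/seteqP; split => t /=; rewrite !in_itv /= E; case: (lerP t x) => h.
    - by move=> [/andP[? ?] /andP[? ?]]; apply/andP; split; lra.
    - by move=> [/andP[? ?] /andP[? ?]]; apply/andP; split; lra.
    - by move=> /andP[? ?]; split; apply/andP; split; lra.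
    - by move=> /andP[? ?]; split; apply/andP; split; lra.
  by rewrite itvE; congr EFin; rewrite max_r; lra.
rewrite (_ : _ `&` _ = `[0, x - tau[%classic `|` `]x + tau, 2[%classic); last first.
  apply/seteqP; split => t /=; rewrite !in_itv /= E; case: (lerP t x) => h.
  - by move=> [/andP[? ?] /andP[? ?]]; left; apply/andP; split; lra.
  - by move=> [/andP[? ?] /andP[? ?]]; right; apply/andP; split; lra.
  - by case => /andP[? ?]; split; apply/andP; split; lra.
  - by case => /andP[? ?]; split; apply/andP; split; lra.
rewrite measureU//.
  transitivity ((Num.max 0 (x - tau - 0))%:E + (Num.max 0 (2 - (x + tau)))%:E)%E.
    by congr (_ + _)%E; [exact: itvE'|exact: itvE].
  by rewrite -EFinD; congr EFin; rewrite !max_r; lra.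
by rewrite -subset0 => t [] /=; rewrite !in_itv /= => /andP[? ?] /andP[? ?]; lra.
Qed.

Lemma circle_far_marginal (tau x : R) : 0 <= tau <= 1 ->
  \int[circle_prob]_t ((~~ circle_close tau x t)%:R : R) = 1 - tau.
Proof.
move=> t01; have := circle_repP x; set y := circle_rep x => y02.
have farE t : (~~ circle_close tau x t)%:R = 1 - (circle_close tau x t)%:R :> R.
  by case: circle_close; rewrite ?subrr ?subr0.
have mfar : measurable_fun setT (fun t => (~~ circle_close tau x t)%:R : R).
  under eq_fun do rewrite farE.
  by apply: measurable_funB => //; apply: measurable_circle_close => //; exact: measurable_cst.
rewrite /Rintegral -integral_circle_prob//.
pose F : set (measurableTypeR R) := [set t | ~~ circle_close tau x t].
rewrite (eq_integral (fun t : measurableTypeR R => (\1_F t)%:E)); last first.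
  by move=> t _; rewrite indicE /F; case: (boolP (circle_close _ _ _)) => h;
    [rewrite memNset//= h|rewrite mem_set].
have mF : measurable F.
  rewrite -[F]setTI (_ : _ `&` _ = setT `&`
      (fun t => (~~ circle_close tau x t)%:R : R) @^-1` [set 1]).
    exact: mfar.
  apply/seteqP; split => t /= [_]; rewrite /F /=; first by move=> ->.
  by case: circle_close => //= /esym/eqP; rewrite oner_eq0.
rewrite integral_indic// setIC (_ : _ `&` F = `[0, 2[ `&` [set t | tau < circd y t]).
  by rewrite [X in (_ * X)%E](lebesgue_far t01 y02) -EFinM /=; lra.
apply/seteqP; split => t /=; rewrite in_itv /= => -[t02];
  by rewrite /F /circle_close /= -/y (circle_rep_id t02) -ltNge.
Qed.

(** Homogeneity of the circle, in the form used later: the graph argument takes from the circle only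
    the symmetry and measurability of the kernel and this constant marginal. *)
Lemma circle_close_marginal (tau x : R) : 0 <= tau <= 1 ->
  \int[circle_prob]_t ((circle_close tau x t)%:R : R) = tau.
Proof.
move=> t01; have farE t : (circle_close tau x t)%:R = 1 - (~~ circle_close tau x t)%:R :> R.
  by case: circle_close; rewrite ?subrr ?subr0.
have mclose : measurable_fun setT (fun t => (circle_close tau x t)%:R : R).
  by apply: measurable_circle_close => //; exact: measurable_cst.
have far_close t : (~~ circle_close tau x t)%:R = 1 - (circle_close tau x t)%:R :> R.
  by case: circle_close; rewrite ?subrr ?subr0.
have int_bool (b : R -> bool) : measurable_fun setT (fun t => (b t)%:R : R) ->
    circle_prob.-integrable setT (EFin \o (fun t => (b t)%:R)).
  move=> mb; apply: measurable_bounded_integrable => //.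
    by rewrite (le_lt_trans (probability_le1 _ _))// ltry.
  exists 1; split; [exact: num_real|move=> M M1 t _ /=].
  by rewrite ger0_norm// (le_trans _ (ltW M1))// lern1 leq_b1.
under eq_Rintegral do rewrite farE.
rewrite RintegralB//.
- by rewrite circle_far_marginal// Rintegral_cst// [X in fine X]probability_setT /=; lra.
- exact: (int_bool (fun=> true)).
- apply: int_bool; under eq_fun do rewrite far_close.
  exact: measurable_funB.
Qed.

End UniformCircle.

(** * Relative entropy *)

Section RelativeEntropy.
Variable R : realType.

Lemma ln_le_subr1 (x : R) : 0 < x -> ln x <= x - 1.
Proof.
by move=> x0; have := @le_ln1Dx R (x - 1); rewrite addrCA subrr addr0; apply; lra.
Qed.

(* [|A - Q| <= c/2 (sqrt A - sqrt Q)^2 + (sqrt A + sqrt Q)^2 / (2c)], and the squared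
   Hellinger distance is dominated by the relative entropy because
   [ln (sqrt (Q / A)) <= sqrt (Q / A) - 1]. *)
Lemma abs_sub_le_entropy (A Q c : R) : 0 <= A -> 0 < Q -> 0 < c ->
  `|A - Q| <= c / 2 * (A * ln (A / Q) - A + Q) + (A + Q) / c.
Proof.
move=> A0 Q0 c0.
pose x := Num.sqrt A; pose y := Num.sqrt Q.
have x0 : 0 <= x := sqrtr_ge0 A.
have y0 : 0 < y by rewrite sqrtr_gt0.
have Ax : A = x ^+ 2 by rewrite sqr_sqrtr.
have Qy : Q = y ^+ 2 by rewrite sqr_sqrtr// ltW.
have ent : 2 * x ^+ 2 - 2 * x * y <= x ^+ 2 * ln (x ^+ 2 / y ^+ 2).
  have [x_eq0|x_neq0] := eqVneq x 0; first by rewrite x_eq0 expr0n/= !mul0r mulr0 mul0r subrr.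
  have xp : 0 < x by rewrite lt_neqAle eq_sym x_neq0.
  have -> : x ^+ 2 / y ^+ 2 = (y / x) ^- 2 by field; rewrite !gt_eqF.
  rewrite lnV ?posrE ?exprn_gt0 ?divr_gt0// lnXn ?divr_gt0//.
  have h : ln (y / x) <= y / x - 1 by rewrite ln_le_subr1// divr_gt0.
  have : x ^+ 2 * ln (y / x) <= x ^+ 2 * (y / x - 1) by rewrite ler_wpM2l// exprn_ge0.
  have -> : x ^+ 2 * (y / x - 1) = x * y - x ^+ 2 by field.
  by rewrite mulrN -mulr_natr mulrA; lra.
have abs_le : `|A - Q| <= c / 2 * (x - y) ^+ 2 + (x + y) ^+ 2 / (2 * c).
  have cV : c * c^-1 = 1 by rewrite divff// gt_eqF.
  have -> : A - Q = (x - y) * (x + y) by rewrite Ax Qy; ring.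
  have sq1 : 0 <= c / 2 * ((x - y) - (x + y) / c) ^+ 2.
    by rewrite mulr_ge0 ?sqr_ge0// divr_ge0 ?ltW.
  have sq2 : 0 <= c / 2 * ((x - y) + (x + y) / c) ^+ 2.
    by rewrite mulr_ge0 ?sqr_ge0// divr_ge0 ?ltW.
  have E1 : c / 2 * ((x - y) - (x + y) / c) ^+ 2 =
    c / 2 * (x - y) ^+ 2 + (x + y) ^+ 2 / (2 * c) - (x - y) * (x + y).
    by field; rewrite gt_eqF.
  have E2 : c / 2 * ((x - y) + (x + y) / c) ^+ 2 =
    c / 2 * (x - y) ^+ 2 + (x + y) ^+ 2 / (2 * c) + (x - y) * (x + y).
    by field; rewrite gt_eqF.
  by rewrite ler_norml; apply/andP; split; lra.
apply: (le_trans abs_le); rewrite Ax Qy; apply: lerD.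
  by rewrite ler_pM2l ?divr_gt0//; nra.
rewrite invfM mulrA ler_pM2r ?invr_gt0// ler_pdivrMr//.
by have := sqr_ge0 (x - y); nra.
Qed.

(** Pinsker's inequality up to a constant, in a form linear in the entropy: [c] replaces the square
    root. The terms [- A s + Q s] cancel because both families sum to 1. *)
Lemma sum_abs_sub_le_entropy (S : finType) (A Q : S -> R) (c : R) :
  (forall s, 0 <= A s) -> (forall s, 0 < Q s) -> 0 < c ->
  \sum_s A s = 1 -> \sum_s Q s = 1 ->
  \sum_s `|A s - Q s| <= c / 2 * (\sum_s A s * ln (A s / Q s)) + 2 / c.
Proof.
move=> A0 Q0 c0 A1 Q1.
apply: (@le_trans _ _
  (\sum_s (c / 2 * (A s * ln (A s / Q s) - A s + Q s) + (A s + Q s) / c))).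
  by apply: ler_sum => s _; exact: abs_sub_le_entropy.
rewrite big_split /= -mulr_sumr -mulr_suml !big_split /= sumrN A1 Q1.
by rewrite subrK.
Qed.

(** The chain rule, with the conditional entropy bounded by a chi-square term through
    [ln x <= x - 1]. Since [B] dominates [a^2 / A], no division by a vanishing [A s] occurs. *)
Lemma entropy_chain_le (S T : finType) (a B : S -> T -> R) (A Q : S -> R) (q : T -> R) :
  (forall s t, 0 <= a s t) -> (forall s t, a s t <= A s) ->
  (forall s, 0 < Q s) -> (forall t, 0 < q t) ->
  (forall s, \sum_t a s t = A s) ->
  (forall s t, 0 <= B s t) -> (forall s t, a s t ^+ 2 <= A s * B s t) ->
  \sum_s \sum_t a s t * ln (a s t / (Q s * q t)) <=
  \sum_s A s * ln (A s / Q s) + \sum_s \sum_t B s t / q t - \sum_s A s.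
Proof.
move=> a0 aA Q0 q0 sa B0 aB.
have term s t : a s t * ln (a s t / (Q s * q t)) <=
    a s t * ln (A s / Q s) + B s t / q t - a s t.
  have [a_eq0|a_neq0] := eqVneq (a s t) 0.
    by rewrite a_eq0 !mul0r add0r subr0 divr_ge0// ltW.
  have ap : 0 < a s t by rewrite lt_neqAle eq_sym a_neq0/=.
  have Ap : 0 < A s := lt_le_trans ap (aA s t).
  have -> : a s t / (Q s * q t) = (A s / Q s) * (a s t / (A s * q t)).
    by field; rewrite !gt_eqF.
  rewrite lnM ?posrE ?divr_gt0 ?mulr_gt0// mulrDr -addrA lerD2l.
  have h : ln (a s t / (A s * q t)) <= a s t / (A s * q t) - 1.
    by rewrite ln_le_subr1// divr_gt0// mulr_gt0.
  apply: (@le_trans _ _ (a s t * (a s t / (A s * q t) - 1))).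
    by rewrite ler_wpM2l.
  rewrite mulrBr mulr1 lerD2r mulrA -expr2 invfM mulrA ler_pM2r ?invr_gt0//.
  by rewrite ler_pdivrMr// mulrC.
apply: (@le_trans _ _ (\sum_s \sum_t (a s t * ln (A s / Q s) + B s t / q t - a s t))).
  by apply: ler_sum => s _; apply: ler_sum => t _; exact: term.
rewrite le_eqVlt; apply/orP; left; apply/eqP.
rewrite -big_split /= -sumrB; apply: eq_bigr => s _.
by rewrite !big_split /= -mulr_suml sumrN sa.
Qed.

End RelativeEntropy.

(** * Second-order expansion of the likelihood ratio *)

Section SecondOrder.
Variable R : realType.
Implicit Types (x u : R).

(** The linear term is kept exact because it averages to zero in the application ([vavg2_corr]); all
    the rest goes into a quadratic remainder. Induction on [k]. *)
Lemma expn1D_le_quadratic (u M : R) k : -1 <= u -> 1 <= M -> 1 + u <= M ->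
  (1 + u) ^+ k <= 1 + k%:R * u + k%:R ^+ 2 * u ^+ 2 * M ^+ k.
Proof.
move=> u1 M1 uM; elim: k => [|k ih]; first by rewrite expr0 expr0n /= !mul0r !addr0.
have Mk : 1 <= M ^+ k by rewrite exprn_ege1.
have u0 : 0 <= 1 + u by lra.
rewrite exprS; apply: (le_trans (ler_wpM2l u0 ih)); rewrite [M ^+ k.+1]exprS.
set K : R := k%:R; have K0 : 0 <= K by rewrite ler0n.
have -> : k.+1%:R = K + 1 :> R by rewrite -natr1.
set N := M ^+ k in Mk *.
have u2 : 0 <= u ^+ 2 := sqr_ge0 u.
have N0 : 0 <= N by lra.
have M0 : 0 <= M by lra.
have MN : 1 <= M * N by nra.
have h1 : K ^+ 2 * u ^+ 2 * N * (1 + u) <= K ^+ 2 * u ^+ 2 * N * M.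
  by rewrite ler_wpM2l// mulr_ge0// mulr_ge0// sqr_ge0.
have h2 : K * u ^+ 2 * 1 <= K * u ^+ 2 * (M * N).
  by rewrite ler_wpM2l// mulr_ge0.
have h3 : 0 <= (K + 1) * u ^+ 2 * (M * N).
  by apply: mulr_ge0; [apply: mulr_ge0 => //; lra|lra].
by lra.
Qed.

Lemma expR_le_1D2x x : 0 <= x <= 2^-1 -> expR x <= 1 + 2 * x.
Proof.
move=> /andP[x0 x1]; have := expR_ge1Dx (- x); rewrite expRN => h.
have e0 := expR_gt0 x.
have : (1 - x) * expR x <= 1.
  by rewrite -[leRHS](mulVf (lt0r_neq0 e0)) ler_wpM2r// ltW.
nra.
Qed.

Lemma expRB1_le x : expR x - 1 <= x * expR x.
Proof.
have := expR_ge1Dx (- x); rewrite expRN => h; have e0 := expR_gt0 x.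
have : (1 - x) * expR x <= 1.
  by rewrite -[leRHS](mulVf (lt0r_neq0 e0)) ler_wpM2r// ltW.
by lra.
Qed.

Lemma bernoulli_le x n : 0 <= x <= 1 -> 1 - n%:R * x <= (1 - x) ^+ n.
Proof.
move=> /andP[x0 x1]; elim: n => [|n ih]; first by rewrite mul0r subr0 expr0.
rewrite exprS; apply: (@le_trans _ _ ((1 - x) * (1 - n%:R * x))); last first.
  by rewrite ler_wpM2l// subr_ge0.
by rewrite -natr1; have : 0 <= n%:R :> R := ler0n _ _; nra.
Qed.

(** After division by [p ^+ 2] the product becomes [Y], and [g = p / (1 - p) * (Y - 1)] with [Y]
    between [1 - 4 * eta] and [expR (4 * S)]. The remainder is then bounded by a product of factors
    affine in the [m c], whose average factorises over the coordinates. *)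
Lemma overlap_product_bound (s : seq nat) (m : nat -> R) (lam eta : R) (k : nat) :
  let p := (1 - lam) ^+ size s in
  let g := (\prod_(c <- s) (1 - 2 * lam + m c) - p ^+ 2) / (p * (1 - p)) in
  0 <= lam <= 2^-1 -> (forall c, 0 <= m c <= lam) ->
  0 < p <= 2^-1 -> 0 < eta <= 1 -> k%:R * eta <= 1 ->
  (size s)%:R * lam ^+ 2 <= eta -> 28 * lam <= eta ->
  (1 + g) ^+ k <= 1 + k%:R * g +
    256 * k%:R ^+ 2 * p ^+ 2 * eta ^+ 2 * \prod_(c <- s) (1 + 28 / eta * m c).
Proof.
move=> p g /andP[l0 l1] mP /andP[p0 p1] /andP[e0 e1] ke dle lle.
have m0 c : 0 <= m c by have /andP[] := mP c.
have ml c : m c <= lam by have /andP[] := mP c.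
pose tau2 := (1 - lam) ^+ 2.
have t20 : 0 < tau2 by rewrite exprn_gt0//; lra.
have t24 : 1 <= 4 * tau2 by rewrite /tau2; nra.
pose Y := \prod_(c <- s) ((1 - 2 * lam + m c) / tau2).
pose S := \sum_(c <- s) m c.
have S0 : 0 <= S by exact: sumr_ge0.
have YE : \prod_(c <- s) (1 - 2 * lam + m c) = p ^+ 2 * Y.
  have -> : p ^+ 2 = \prod_(c <- s) tau2.
    by rewrite big_const_seq count_predT iter_mulr_1 /p /tau2 -!exprM mulnC.
  rewrite -big_split /=; apply: eq_bigr => c _.
  by rewrite [RHS]mulrC divfK// gt_eqF.
have YleS : Y <= expR (4 * S).
  rewrite /S mulr_sumr expR_sum; apply: ler_prod => c _; apply/andP; split.
    by rewrite divr_ge0 ?(ltW t20)//; have := m0 c; lra.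
  apply: (le_trans _ (expR_ge1Dx _)); rewrite ler_pdivrMr//.
  by have := m0 c; rewrite /tau2 in t24 *; nra.
(* Dropping [m c], each factor is [1 - lam ^+ 2 / tau2], hence at least [1 - 4 * lam ^+ 2] because
   [tau2] is at least 1/4; Bernoulli's inequality does the rest. *)
have Yge : 1 - 4 * eta <= Y.
  apply: (@le_trans _ _ ((1 - 4 * lam ^+ 2) ^+ size s)).
    apply: (@le_trans _ _ (1 - (size s)%:R * (4 * lam ^+ 2))); first by lra.
    by apply: bernoulli_le; apply/andP; split; nra.
  rewrite -(count_predT s) -iter_mulr_1 -big_const_seq; apply: ler_prod => c _.
  apply/andP; split; first by nra.
  by rewrite ler_pdivlMr// /tau2; have := m0 c; rewrite /tau2 in t24; nra.
(* At the scale [1 / eta], [S <= eta * W] extracts the small factor [eta], while [k%:R * eta <= 1]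
   keeps the [k]-th power of [expR (4 * S)] below [W ^+ 4]. *)
have [W [WE W1]] : exists W, W = expR (S / eta) /\ 1 <= W.
  exists (expR (S / eta)); split=> //.
  by rewrite -[leLHS]expR0 ler_expR divr_ge0// ltW.
have e4W : expR (4 * S) <= W ^+ 4.
  rewrite WE -expRM_natl ler_expR ler_pM2l// ler_pdivlMr//.
  by nra.
have SW : S <= eta * W.
  rewrite WE -ler_pdivrMl// mulrC.
  by apply: (le_trans _ (expR_ge1Dx _)); rewrite lerDr.
have W4 : 1 <= W ^+ 4 by exact: exprn_ege1.
have W5 : 1 <= W ^+ 5 by exact: exprn_ege1.
have Yabs : `|Y - 1| <= 8 * eta * W ^+ 5.
  have h1 : Y - 1 <= 4 * S * W ^+ 4.
    have := expRB1_le (4 * S) => h.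
    have : 4 * S * expR (4 * S) <= 4 * S * W ^+ 4 by rewrite ler_wpM2l//; lra.
    by lra.
  have h2 : 4 * S * W ^+ 4 <= 4 * (eta * W) * W ^+ 4.
    by rewrite ler_wpM2r//; lra.
  have h3 : 4 * (eta * W) * W ^+ 4 = 4 * eta * W ^+ 5 by ring.
  have h4 : 4 * eta <= 4 * eta * W ^+ 5 by rewrite ler_peMr//; lra.
  by rewrite ler_norml; apply/andP; split; lra.
pose a := p / (1 - p).
have a0 : 0 <= a by rewrite divr_ge0; lra.
have a1 : a <= 1 by rewrite ler_pdivrMr; lra.
have a2 : a <= 2 * p by rewrite ler_pdivrMr; nra.
have gE : g = a * (Y - 1).
  by rewrite /g YE /a; field; rewrite !gt_eqF//; lra.
have Y0 : 0 <= Y.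
  apply: prodr_ge0 => c _; rewrite divr_ge0 ?(ltW t20)//; have := m0 c; lra.
have eS1 : 1 <= expR (4 * S) by rewrite -[leLHS]expR0 ler_expR mulr_ge0.
apply: (le_trans (@expn1D_le_quadratic g (expR (4 * S)) k _ eS1 _)).
- by rewrite gE; nra.
- by rewrite gE; nra.
rewrite lerD2l.
have MkW : expR (4 * S) ^+ k <= W ^+ 4.
  rewrite -expRM_natl WE -expRM_natl ler_expR mulrCA ler_pM2l// ler_pdivlMr//.
  by nra.
have g2 : g ^+ 2 <= 256 * p ^+ 2 * eta ^+ 2 * W ^+ 10.
  have -> : 256 * p ^+ 2 * eta ^+ 2 * W ^+ 10 = (2 * p * (8 * eta * W ^+ 5)) ^+ 2 by ring.
  rewrite -[leLHS]real_normK ?num_real// lerXn2r// ?nnegrE//.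
    by rewrite !mulr_ge0// ?exprn_ge0//; lra.
  by rewrite gE normrM (ger0_norm a0) ler_pM.
(* The exponent is 10 from [g ^+ 2] plus 4 from the [k]-th power. The bound [expR x <= 1 + 2 * x]
   applies with [x = 14 * (m c / eta)], at most 1/2 since [28 * lam <= eta]. *)
have W14 : W ^+ 14 <= \prod_(c <- s) (1 + 28 / eta * m c).
  rewrite WE -expRM_natl /S mulr_suml mulr_sumr expR_sum; apply: ler_prod => c _.
  rewrite expR_ge0 /=.
  have -> : 28 / eta * m c = 2 * (14 * (m c / eta)) by ring.
  apply: expR_le_1D2x; apply/andP; split.
    by rewrite mulr_ge0// divr_ge0// ltW.
  rewrite mulrA ler_pdivrMr//; have := ml c; lra.
apply: (@le_trans _ _ (k%:R ^+ 2 * (256 * p ^+ 2 * eta ^+ 2 * W ^+ 10) * W ^+ 4)).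
  apply: ler_pM => //.
  - by rewrite mulr_ge0 ?sqr_ge0.
  - by rewrite ler_wpM2l ?sqr_ge0.
have -> : k%:R ^+ 2 * (256 * p ^+ 2 * eta ^+ 2 * W ^+ 10) * W ^+ 4 =
  256 * k%:R ^+ 2 * p ^+ 2 * eta ^+ 2 * W ^+ 14 by ring.
apply: ler_wpM2l W14.
have -> : 256 * k%:R ^+ 2 * p ^+ 2 * eta ^+ 2 = 256 * (k%:R * p * eta) ^+ 2 by ring.
by rewrite mulr_ge0 ?sqr_ge0.
Qed.

End SecondOrder.

(** * Graphs generated by a kernel on a product space *)

Section KernelGraph.
Context (R : realType) (dX : measure_display) (X : measurableType dX).
Variables (P : probability X R) (b : X -> X -> bool) (tau : R) (dim : nat).
Hypothesis bC : forall x y, b x y = b y x.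
Hypothesis measurable_b : forall (d : measure_display) (T : measurableType d) (f g : T -> X),
  measurable_fun setT f -> measurable_fun setT g ->
  measurable_fun setT (fun t => (b (f t) (g t))%:R : R).
Hypothesis b_marginal : forall x, \int[P]_t ((b x t)%:R : R) = tau.

(** A point assigns positions to infinitely many vertices, so that an auxiliary vertex or an
    independent copy of a vertex is always at hand. *)
Local Notation Omega := (nat * nat -> X).
Local Notation lam := (1 - tau).
Local Notation p := (tau ^+ dim).
Local Notation avgP := (avg P).
Local Notation avgsP := (avgs P).
Implicit Types (f g : Omega -> R) (z : Omega) (u v w c k : nat).

Definition coords v : seq (nat * nat) := [seq (v, c) | c <- iota 0 dim].

Lemma mem_coords v i : i \in coords v -> i.1 = v.
Proof. by case/mapP => c _ ->. Qed.

Lemma coords_uniq v : uniq (coords v).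
Proof. by rewrite map_inj_uniq ?iota_uniq// => c c' []. Qed.

Definition vindep v f := forall c, indep (v, c) f.

Lemma vindepP v f : vindep v f -> {in coords v, forall i, indep i f}.
Proof. by move=> fv [w c] /mem_coords /= ->. Qed.

Lemma vindep_avgs v s f : vindep v f -> vindep v (avgsP s f).
Proof. by move=> fv c; exact: indep_avgs. Qed.

Definition close u v c : Omega -> R := fun z => (b (z (u, c)) (z (v, c)))%:R.

Definition far u v c : Omega -> R := fun z => 1 - close u v c z.

Lemma mbf_close u v c : mbf (close u v c).
Proof.
split; first by move=> d T g mg; exact: measurable_b.
by exists 1 => z; rewrite /close; case: b; rewrite ?normr1 ?normr0.
Qed.

Lemma mbf_far u v c : mbf (far u v c).
Proof.
rewrite /far (_ : (fun z => _) = fun z => 1 + (-1) * close u v c z).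
  by apply: mbfD; [exact: mbf_cst|apply: mbfZ; exact: mbf_close].
by apply/funext => z; rewrite mulN1r.
Qed.

Lemma closeC u v c : close u v c = close v u c.
Proof. by apply/funext => z; rewrite /close bC. Qed.

Lemma far01 u v c z : 0 <= far u v c z <= 1.
Proof. by rewrite /far /close; case: b; rewrite ?subrr ?subr0 ler01 lexx. Qed.

Lemma updE (i : nat * nat) z t : upd z i t i = t.
Proof. by rewrite /upd eqxx. Qed.

Lemma updN (i j : nat * nat) z t : j != i -> upd z i t j = z j.
Proof. by rewrite /upd => /negbTE ->. Qed.

Lemma indep_close (i : nat * nat) u v c : (u, c) != i -> (v, c) != i -> indep i (close u v c).
Proof. by move=> ui vi z t; rewrite /close !updN. Qed.

Lemma indep_far (i : nat * nat) u v c : (u, c) != i -> (v, c) != i -> indep i (far u v c).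
Proof. by move=> ui vi z t; rewrite /far indep_close. Qed.

Lemma neq_vertex u v c c' : u != v -> (u, c) != (v, c').
Proof. by apply: contraNneq => -[->]. Qed.

Lemma neq_coord v c c' : c != c' -> (v, c') != (v, c).
Proof. by apply: contraNneq => -[->]. Qed.

Lemma avg_close u v c : u != v -> avgP (v, c) (close u v c) = fun=> tau.
Proof.
move=> uv; apply/funext => z; rewrite /avg /close.
under eq_Rintegral do rewrite updE updN ?neq_vertex//.
exact: b_marginal.
Qed.

Lemma avg_far u v c : u != v -> avgP (v, c) (far u v c) = fun=> lam.
Proof.
move=> uv; rewrite /far (_ : (fun z => _) = fun z => 1 + (-1) * close u v c z); last first.
  by apply/funext => z; rewrite mulN1r.
rewrite avgD ?avg_cst ?avgZ ?avg_close//; do ?exact: mbf_close; do ?exact: mbf_cst.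
- by apply/funext => z; rewrite mulN1r.
- by apply: mbfZ; exact: mbf_close.
Qed.

(** * Points far from two given points *)

Definition overlap (x y : X) : R := \int[P]_t ((1 - (b t x)%:R) * (1 - (b t y)%:R)).

Definition overlapf u v c : Omega -> R := fun z => overlap (z (u, c)) (z (v, c)).

(** Writing the overlap as an average over a third vertex [w] lets the coordinate calculus give its
    measurability, bounds and mean. *)
Lemma overlapfE w u v c : u != w -> v != w ->
  overlapf u v c = avgP (w, c) (fun z => far w u c z * far w v c z).
Proof.
move=> uw vw; apply/funext => z; rewrite /overlapf /overlap /avg.
apply: eq_Rintegral => t _; rewrite /far /close updE !updN ?neq_vertex//.
Qed.

Lemma ex_fresh u v : exists w, (u != w) && (v != w).
Proof.
exists (maxn u v).+1; apply/andP; split; rewrite neq_ltn; apply/orP; left;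
  by rewrite ltnS ?leq_maxl ?leq_maxr.
Qed.

Lemma mbf_far2 w u v c : mbf (fun z => far w u c z * far w v c z).
Proof. by apply: mbfM; exact: mbf_far. Qed.

Lemma mbf_overlapf u v c : mbf (overlapf u v c).
Proof.
have [w /andP[uw vw]] := ex_fresh u v; rewrite (overlapfE _ uw vw).
by apply: mbf_avg; exact: mbf_far2.
Qed.

Lemma overlapf_bounds u v c z : 0 <= overlapf u v c z <= lam.
Proof.
have [w /andP[uw vw]] := ex_fresh u v; rewrite (overlapfE _ uw vw).
have far2_ge0 z' : 0 <= far w u c z' * far w v c z'.
  by have /andP[? _] := far01 w u c z'; have /andP[? _] := far01 w v c z'; exact: mulr_ge0.
apply/andP; split.
  have := @avg_le _ _ _ _ P (fun=> 0) _ (w, c) (mbf_cst _) (mbf_far2 w u v c) far2_ge0 z.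
  by rewrite avg_cst.
have E : avgP (w, c) (far w u c) z = lam.
  rewrite (_ : far w u c = far u w c) ?avg_far//.
  by apply/funext => z'; rewrite /far closeC.
rewrite -E; apply: avg_le; [exact: mbf_far2|exact: mbf_far|move=> z'].
by have /andP[? ?] := far01 w u c z'; have /andP[? ?] := far01 w v c z'; exact: ler_piMr.
Qed.

(** Averaging over [v] before [w], each step uses the constant marginal; the result is the same for
    every position of [u]. *)
Lemma avg_overlapf u v c : u != v -> avgP (v, c) (overlapf u v c) = fun=> lam ^+ 2.
Proof.
move=> uv; have [w /andP[uw vw]] := ex_fresh u v; rewrite (overlapfE _ uw vw).
rewrite avg_comm; last exact: mbf_far2.
rewrite avgM_indep; last exact: mbf_far.
  rewrite avg_far 1?eq_sym//.
  rewrite (_ : (fun z => _) = fun z => lam * far u w c z); last first.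
    by apply/funext => z; rewrite mulrC /far closeC.
  by rewrite avgZ ?avg_far//; exact: mbf_far.
by apply: indep_far; rewrite neq_vertex// eq_sym.
Qed.

Lemma indep_overlapf (i : nat * nat) u v c :
  (u, c) != i -> (v, c) != i -> indep i (overlapf u v c).
Proof. by move=> ui vi z t; rewrite /overlapf !updN. Qed.

(** * Averaging over the position of a vertex *)

Definition vavg v f := avgsP (coords v) f.

Lemma vavg_prod v (F : nat -> Omega -> R) : (forall c, mbf (F c)) ->
  (forall c c', c != c' -> indep (v, c) (F c')) ->
  vavg v (fun z => \prod_(c <- iota 0 dim) F c z) =
  fun z => \prod_(c <- iota 0 dim) avgP (v, c) (F c) z.
Proof.
move=> mF Fi; have := @avgs_prod _ _ _ _ P (coords v) (fun i => F i.2) (coords_uniq v).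
rewrite (_ : (fun z => \prod_(i <- coords v) F i.2 z) =
    fun z => \prod_(c <- iota 0 dim) F c z); last first.
  by apply/funext => z; rewrite big_map.
rewrite /vavg => ->.
- by apply/funext => z; rewrite big_map.
- by move=> i; exact: mF.
- move=> _ _ /mapP[c _ ->] /mapP[c' _ ->] cc'; apply: Fi.
  by apply: contraNneq cc' => ->.
Qed.

Definition adj u v z : bool := all (fun c => b (z (u, c)) (z (v, c))) (iota 0 dim).

Lemma adjE u v z : (adj u v z)%:R = \prod_(c <- iota 0 dim) close u v c z.
Proof.
rewrite /adj; elim: (iota 0 dim) => [|c s ih] /=; first by rewrite big_nil.
by rewrite big_cons -ih /close; case: b; rewrite ?mul1r ?mul0r.
Qed.

Lemma adjC u v z : adj u v z = adj v u z.
Proof. by apply: eq_all => c; rewrite bC. Qed.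

Lemma mbf_adj u v : mbf (fun z => (adj u v z)%:R : R).
Proof.
rewrite (_ : (fun z => _) = fun z => \prod_(c <- iota 0 dim) close u v c z).
  by apply: mbf_prod => c; exact: mbf_close.
by apply/funext => z; rewrite adjE.
Qed.

Lemma adj_upd u v i z t : u != i.1 -> v != i.1 -> adj u v (upd z i t) = adj u v z.
Proof.
case: i => w c /= uw vw; apply: eq_all => c'.
by rewrite !updN ?neq_vertex.
Qed.

Lemma vavg_adj u v : u != v -> vavg v (fun z => (adj u v z)%:R) = fun=> p.
Proof.
move=> uv; rewrite (_ : (fun z => _) = fun z => \prod_(c <- iota 0 dim) close u v c z); last first.
  by apply/funext => z; rewrite adjE.
rewrite vavg_prod.
- apply/funext => z; under eq_bigr do rewrite avg_close//.
  by rewrite big_const_seq count_predT iter_mulr_1 size_iota.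
- by move=> c; exact: mbf_close.
- by move=> c c' cc'; apply: indep_close; [exact: neq_vertex|exact: neq_coord].
Qed.

Lemma vavg_adj2 w u v : u != w -> v != w ->
  vavg w (fun z => (adj w u z)%:R * (adj w v z)%:R) =
  fun z => \prod_(c <- iota 0 dim) (1 - 2 * lam + overlapf u v c z).
Proof.
move=> uw vw.
rewrite (_ : (fun z => _) =
    fun z => \prod_(c <- iota 0 dim) (close w u c z * close w v c z)); last first.
  by apply/funext => z; rewrite !adjE big_split.
rewrite vavg_prod.
- apply/funext => z; apply: eq_bigr => c _.
  (* Inclusion-exclusion: with each closeness equal to one minus farness, the product of two of them
     is affine in both and in the product of the farnesses, whose mean is the overlap. *)
  rewrite (_ : (fun z => _) = fun z => (-1 + close w u c z) +
      (close w v c z + far w u c z * far w v c z)); last first.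
    by apply/funext => z'; rewrite /far; ring.
  rewrite (closeC w u) (closeC w v).
  have [mu mv] := (mbf_close u w c, mbf_close v w c).
  rewrite avgD.
  + rewrite avgD ?avgD//; do ?exact: mbf_cst; do ?exact: mbf_far2.
    by rewrite avg_cst !avg_close// -overlapfE//; lra.
  + by apply: mbfD => //; exact: mbf_cst.
  + by apply: mbfD => //; exact: mbf_far2.
- by move=> c; apply: mbfM; exact: mbf_close.
- by move=> c c' cc' z t; congr (_ * _);
    apply: indep_close; [exact: neq_coord|exact: neq_vertex|exact: neq_coord|exact: neq_vertex].
Qed.

(** Different coordinates are independent, and averaging over [v] alone already turns each overlap
    into [lam ^+ 2]. *)
Lemma vavg2_prod_affine u v (al be : R) : u != v ->
  vavg u (vavg v (fun z => \prod_(c <- iota 0 dim) (al + be * overlapf u v c z))) =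
  fun=> (al + be * lam ^+ 2) ^+ dim.
Proof.
move=> uv.
have mF c : mbf (fun z => be * overlapf u v c z) by apply: mbfZ; exact: mbf_overlapf.
rewrite vavg_prod.
- rewrite (_ : (fun z => _) = fun=> (al + be * lam ^+ 2) ^+ dim); first exact: avgs_cst.
  apply/funext => z; rewrite (eq_bigr (fun=> al + be * lam ^+ 2)) => [|c _].
    by rewrite big_const_seq count_predT iter_mulr_1 size_iota.
  rewrite avgD// ?avg_cst ?avgZ ?avg_overlapf//; first exact: mbf_overlapf.
  exact: mbf_cst.
- by move=> c; apply: mbfD => //; exact: mbf_cst.
- by move=> c c' cc' z t; rewrite indep_overlapf//; [exact: neq_vertex|exact: neq_coord].
Qed.

(** * Second moment of the row likelihood ratio *)

Hypothesis p_gt0 : 0 < p.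
Hypothesis p_lt1 : p < 1.

Definition bern (e : bool) : R := if e then p else 1 - p.

Lemma bern_gt0 e : 0 < bern e.
Proof. by case: e; rewrite /bern ?subr_gt0. Qed.

(* The factor contributed by vertex [w] to the second moment of the likelihood ratio of the
   rows of [u] and [v]. *)
Definition lratio w u v z : R :=
  \sum_(e : bool) (adj w u z == e)%:R * (adj w v z == e)%:R / bern e.

(** Given the positions of [u] and [v], this is the covariance of their adjacencies to a common
    random vertex, divided by the Bernoulli variance; it is the [g] of the overview. *)
Definition corr u v z : R :=
  (\prod_(c <- iota 0 dim) (1 - 2 * lam + overlapf u v c z) - p ^+ 2) / (p * (1 - p)).

Lemma mbf_adj_eq u v e : mbf (fun z => (adj u v z == e)%:R : R).
Proof.
case: e; first by rewrite (_ : (fun z => _) = fun z => (adj u v z)%:R);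
  [exact: mbf_adj|apply/funext => z; rewrite eqb_id].
rewrite (_ : (fun z => _) = fun z => 1 + (-1) * (adj u v z)%:R).
  by apply: mbfD; [exact: mbf_cst|apply: mbfZ; exact: mbf_adj].
by apply/funext => z; case: adj; rewrite /= ?mulr1 ?mulr0 ?subrr ?addr0.
Qed.

Lemma mbf_lratio w u v : mbf (lratio w u v).
Proof.
apply: mbf_sum => e.
by apply: mbfM; [apply: mbfM; exact: mbf_adj_eq|exact: mbf_cst].
Qed.

Lemma vavg_lratio w u v : u != w -> v != w ->
  vavg w (lratio w u v) = fun z => 1 + corr u v z.
Proof.
move=> uw vw.
(* On 0-1 values [lratio] is affine in the two adjacencies and their product; the adjacencies
   average to [p], so only the joint term depends on [u] and [v]. *)
rewrite (_ : lratio w u v = fun z =>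
    ((1 - p)^-1 + (- (1 - p)^-1) * (adj u w z)%:R) +
    ((- (1 - p)^-1) * (adj v w z)%:R +
     (p^-1 + (1 - p)^-1) * ((adj w u z)%:R * (adj w v z)%:R))); last first.
  apply/funext => z; rewrite /lratio big_bool /= /bern (adjC w u) (adjC w v).
  by case: (adj u w z); case: (adj v w z); rewrite /=; ring.
have [mu mv] := (mbf_adj u w, mbf_adj v w).
have mm : mbf (fun z => (adj w u z)%:R * (adj w v z)%:R : R).
  by apply: mbfM; exact: mbf_adj.
have mc := @mbf_cst _ _ X (nat * nat)%type (1 - p)^-1.
have [mu' mv'] := (mbfZ (- (1 - p)^-1) mu, mbfZ (- (1 - p)^-1) mv).
have mm' := mbfZ (p^-1 + (1 - p)^-1) mm.
rewrite /vavg avgsD; [|exact: mbfD|exact: mbfD].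
rewrite avgsD// avgsD// !avgsZ// avgs_cst.
have := vavg_adj uw; have := vavg_adj vw; have := vavg_adj2 uw vw; rewrite /vavg => -> -> ->.
apply/funext => z; rewrite /corr.
by field; rewrite !gt_eqF// subr_gt0.
Qed.

Definition allcoords k : seq (nat * nat) := flatten [seq coords v | v <- iota 0 k].

Definition expect k f := avgsP (allcoords k) f.

Lemma allcoordsS k : allcoords k.+1 = allcoords k ++ coords k.
Proof. by rewrite /allcoords -addn1 iotaD add0n map_cat flatten_cat /= cats0. Qed.

Lemma expectS k f : expect k.+1 f = expect k (vavg k f).
Proof. by rewrite /expect allcoordsS avgs_cat. Qed.

Lemma mem_allcoords k i : i \in allcoords k -> (i.1 < k)%N.
Proof.
by case/flatten_mapP => v; rewrite mem_iota add0n /= => vk /mem_coords ->.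
Qed.

Lemma expectM_indep k f g : (forall v, (v < k)%N -> vindep v f) -> mbf g ->
  expect k (fun z => f z * g z) = fun z => f z * expect k g z.
Proof.
move=> fi mg; apply: avgsM_indep => // -[v c] /mem_allcoords /= vk; exact: fi.
Qed.

(** Independence of the vertices: among the first [k] vertices, the factor [F i] depends only on
    vertex [i]. *)
Lemma expect_prod k (F : nat -> Omega -> R) : (forall i, mbf (F i)) ->
  (forall i j, (i < k)%N -> (j < k)%N -> i != j -> vindep i (F j)) ->
  expect k (fun z => \prod_(i < k) F i z) = fun z => \prod_(i < k) vavg i (F i) z.
Proof.
move=> mF; elim: k => [|k ih] Fi; first by apply/funext => z; rewrite /expect /= !big_ord0.
rewrite expectS.
rewrite (_ : (fun z => _) = fun z => (\prod_(i < k) F i z) * F k z); last first.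
  by apply/funext => z; rewrite big_ord_recr.
rewrite /vavg avgsM_indep//; last first.
  move=> -[v c] /mem_coords /= -> z t; apply: eq_bigr => j _.
  have jk := ltn_ord j; apply: Fi; first exact: ltnSn.
    exact: ltn_trans jk (ltnSn k).
  by rewrite neq_ltn jk orbT.
rewrite (_ : (fun z => _ * _) =
    fun z => avgsP (coords k) (F k) z * \prod_(i < k) F i z); last first.
  by apply/funext => z; rewrite mulrC.
rewrite expectM_indep.
- rewrite ih => [|i j ik jk]; last by apply: Fi; exact: leqW.
  by apply/funext => z; rewrite big_ord_recr mulrC.
- move=> v vk; apply: vindep_avgs.
  by apply: Fi; rewrite ?ltnSn ?(leqW vk)// neq_ltn vk.
- exact: mbf_prod.
Qed.

Lemma mbf_corr u v : mbf (corr u v).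
Proof.
apply: mbfM; last exact: mbf_cst.
apply: mbfD; last exact: mbf_cst.
by apply: mbf_prod => c; apply: mbfD; [exact: mbf_cst|exact: mbf_overlapf].
Qed.

(** * Rows of the adjacency matrix and their conditional law *)

Definition row k (r : {ffun 'I_k -> bool}) v z : bool := [forall i : 'I_k, adj i v z == r i].

Definition row_prob k (r : {ffun 'I_k -> bool}) : R := \prod_i bern (r i).

Lemma rowE k (r : {ffun 'I_k -> bool}) v z :
  (row r v z)%:R = \prod_(i < k) (adj i v z == r i)%:R :> R.
Proof.
rewrite /row; case: forallP => [h|/forallP]; first by rewrite big1// => i _; rewrite h.
rewrite negb_forall => /existsP[i /negbTE h].
by rewrite (bigD1 i)//= h mul0r.
Qed.

Lemma mbf_row k (r : {ffun 'I_k -> bool}) v : mbf (fun z => (row r v z)%:R : R).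
Proof.
rewrite (_ : (fun z => _) = fun z => \prod_(i < k) (adj i v z == r i)%:R).
  by apply: mbf_prod => i; exact: mbf_adj_eq.
by apply/funext => z; rewrite rowE.
Qed.

Lemma row_vindep k (r : {ffun 'I_k -> bool}) v w : (k <= w)%N -> v != w ->
  vindep w (fun z => (row r v z)%:R).
Proof.
move=> kw vw c z t; congr ((nat_of_bool _)%:R); apply: eq_forallb => i.
by rewrite adj_upd//= neq_ltn (leq_trans (ltn_ord i) kw).
Qed.

(** The conditional probability that vertex [k] has row [r], as a function of the positions of the
    earlier vertices. *)
Definition cond k (r : {ffun 'I_k -> bool}) := vavg k (fun z => (row r k z)%:R).

Lemma mbf_cond k (r : {ffun 'I_k -> bool}) : mbf (cond r).
Proof. by apply: mbf_avgs; exact: mbf_row. Qed.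

Definition swapv k (i : nat * nat) : nat * nat :=
  (if i.1 == k then k.+1 else if i.1 == k.+1 then k else i.1, i.2).

Lemma swapvK k : involutive (swapv k).
Proof.
move=> [v c]; rewrite /swapv /=; congr pair.
case: (eqVneq v k) => [->|vk]; first by rewrite eqxx gtn_eqF.
by case: (eqVneq v k.+1) => [->|vk']; rewrite ?eqxx// (negbTE vk) (negbTE vk').
Qed.

(** Vertex [k.+1] acts as a copy of vertex [k]: exchanging the two fixes all earlier vertices, and
    [cond r] depends on those only. *)
Lemma cond_rename k (r : {ffun 'I_k -> bool}) :
  cond r = vavg k.+1 (fun z => (row r k.+1 z)%:R).
Proof.
have -> : vavg k.+1 (fun z => (row r k.+1 z)%:R) = fun z => cond r (z \o swapv k).
  rewrite /vavg (_ : coords k.+1 = map (swapv k) (coords k)); last first.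
    by rewrite /coords -map_comp; apply: eq_map => c; rewrite /swapv /= eqxx.
  rewrite -(avgs_map P _ (fun z => (row r k z)%:R) (inv_inj (swapvK k))).
  congr avgsP; apply/funext => z; congr ((nat_of_bool _)%:R).
  apply: eq_forallb => i; congr (_ == _); apply: eq_all => c /=.
  by rewrite /swapv /= eqxx !ltn_eqF// ltnS ltnW.
apply/funext => z; apply: (@avgs_depends _ _ _ _ _ _ _ (fun i => i.1 < k)%N).
  move=> z1 z2 z12; congr ((nat_of_bool _)%:R); apply: eq_forallb => i.
  congr (_ == _); apply: eq_in_all => c cdim.
  by rewrite !z12//= ?ltn_ord ?orbT ?map_f ?orbT.
by move=> [v c] /= vk; rewrite /swapv /= !ltn_eqF// ltnS ltnW.
Qed.

(** The square of an average is a double average over two independent copies, here the vertices [k]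
    and [k.+1]. *)
Lemma cond_sq k (r : {ffun 'I_k -> bool}) :
  (fun z => cond r z ^+ 2) =
  vavg k (vavg k.+1 (fun z => (row r k z)%:R * (row r k.+1 z)%:R)).
Proof.
have kk1 : k != k.+1 by rewrite neq_ltn ltnSn.
rewrite /vavg (avgsM_indep P (s := coords k.+1)); last exact: mbf_row.
  rewrite -/(vavg k.+1 _) -cond_rename.
  rewrite [in RHS](_ : (fun z => _ * _) = fun z => cond r z * (row r k z)%:R); last first.
    by apply/funext => z; rewrite mulrC.
  rewrite avgsM_indep; last exact: mbf_row.
    by apply/funext => z; rewrite expr2.
  rewrite cond_rename; apply: vindepP; apply: vindep_avgs.
  by apply: row_vindep; rewrite // eq_sym.
by apply: vindepP; exact: row_vindep.
Qed.

Lemma row_prob_gt0 k (r : {ffun 'I_k -> bool}) : 0 < row_prob r.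
Proof. by apply: prodr_gt0 => i _; exact: bern_gt0. Qed.

Lemma sum_row_lratio k z :
  \sum_(r : {ffun 'I_k -> bool}) (row_prob r)^-1 * ((row r k z)%:R * (row r k.+1 z)%:R) =
  \prod_(i < k) lratio i k k.+1 z.
Proof.
rewrite /lratio bigA_distr_bigA /=; apply: eq_bigr => r _.
by rewrite !rowE /row_prob -prodfV -!big_split /=; apply: eq_bigr => i _; rewrite mulrC.
Qed.

(** Summed over the rows, the weighted products of the two copies' row indicators become a product
    over earlier vertices. Averaging over these first, with both copies fixed, gives one factor
    [1 + corr] for each. *)
Lemma expect_cond_sq k :
  expect k (fun z => \sum_(r : {ffun 'I_k -> bool}) (row_prob r)^-1 * cond r z ^+ 2) =
  vavg k (vavg k.+1 (fun z => (1 + corr k k.+1 z) ^+ k)).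
Proof.
have m2 (r : {ffun 'I_k -> bool}) : mbf (fun z => (row r k z)%:R * (row r k.+1 z)%:R : R).
  by apply: mbfM; exact: mbf_row.
have mS : mbf (fun z => \prod_(i < k) lratio i k k.+1 z).
  by apply: mbf_prod => i; exact: mbf_lratio.
transitivity (expect k (vavg k (vavg k.+1 (fun z => \prod_(i < k) lratio i k k.+1 z)))).
  congr (expect k _).
  rewrite (_ : (fun z => \prod_(i < k) _) = fun z => \sum_(r : {ffun 'I_k -> bool})
      (row_prob r)^-1 * ((row r k z)%:R * (row r k.+1 z)%:R)); last first.
    by apply/funext => z; rewrite sum_row_lratio.
  rewrite /vavg avgs_sum => [|r]; last exact: mbfZ.
  rewrite avgs_sum => [|r]; last by apply: mbf_avgs; exact: mbfZ.
  apply/funext => z; apply: eq_bigr => r _.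
  rewrite avgsZ// avgsZ; last exact: mbf_avgs.
  by have := cond_sq r => /(congr1 (fun f => f z)) ->.
rewrite /expect /vavg avgs_comm; last exact: mbf_avgs.
congr (avgsP (coords k) _); rewrite avgs_comm//; congr (avgsP (coords k.+1) _).
rewrite -/(expect k _) (expect_prod (F := fun i => lratio i k k.+1)).
- apply/funext => z; rewrite (eq_bigr (fun=> 1 + corr k k.+1 z)) => [|i _].
    by rewrite prodr_const card_ord.
  by rewrite vavg_lratio// neq_ltn ?ltnS ?(ltnW (ltn_ord i)) ?ltn_ord orbT.
- by move=> i; exact: mbf_lratio.
- move=> i j ik jk ij c z t; apply: eq_bigr => e _.
  by rewrite !adj_upd//= ?neq_ltn ?ik ?(ltnW ik) ?orbT// ?ltnS ?(ltnW ik) ?orbT// -neq_ltn eq_sym.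
Qed.

(* Graphs on [k] vertices, stored row by row: the last component of a graph on [k.+1]
   vertices lists the adjacencies of the vertex [k] to the earlier ones. *)
Fixpoint rgraph k : finType :=
  if k is k'.+1 then (rgraph k' * {ffun 'I_k' -> bool})%type : finType else unit.

Fixpoint is_graph k : rgraph k -> Omega -> bool :=
  match k with
  | 0 => fun _ _ => true
  | k'.+1 => fun G z => is_graph G.1 z && row G.2 k' z
  end.

Fixpoint er_prob k : rgraph k -> R :=
  match k with
  | 0 => fun _ => 1
  | k'.+1 => fun G => er_prob G.1 * row_prob G.2
  end.

Lemma er_prob_gt0 k (G : rgraph k) : 0 < er_prob G.
Proof. by elim: k G => //= k ih G; rewrite mulr_gt0 ?row_prob_gt0. Qed.

Lemma sum_row_prob k : \sum_(r : {ffun 'I_k -> bool}) row_prob r = 1.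
Proof.
rewrite /row_prob -(bigA_distr_bigA (fun _ e => bern e)) big1// => i _.
by rewrite big_bool /bern /= addrC subrK.
Qed.

Lemma sum_row k v z : \sum_(r : {ffun 'I_k -> bool}) (row r v z)%:R = 1 :> R.
Proof.
under eq_bigr do rewrite rowE.
rewrite -(bigA_distr_bigA (fun (i : 'I_k) e => (adj i v z == e)%:R)) big1// => i _.
by rewrite big_bool /=; case: adj; rewrite ?addr0 ?add0r.
Qed.

Lemma sum_rgraphS k (F : rgraph k.+1 -> R) :
  \sum_(G : rgraph k.+1) F G = \sum_(G : rgraph k) \sum_r F (G, r).
Proof. by rewrite pair_bigA; apply: eq_bigr => -[G r]. Qed.

Lemma sum_er_prob k : \sum_(G : rgraph k) er_prob G = 1.
Proof.
elim: k => [|k ih]; first by rewrite /= (big_pred1 tt)// => -[].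
rewrite sum_rgraphS /= -[RHS]ih; apply: eq_bigr => G _.
by rewrite -mulr_sumr sum_row_prob mulr1.
Qed.

Lemma sum_is_graph k z : \sum_(G : rgraph k) (is_graph G z)%:R = 1 :> R.
Proof.
elim: k => [|k ih]; first by rewrite /= (big_pred1 tt)// => -[].
rewrite sum_rgraphS /= -[RHS]ih; apply: eq_bigr => G _.
under eq_bigr do rewrite -mulnb natrM.
by rewrite -mulr_sumr sum_row mulr1.
Qed.

Lemma mbf_is_graph k (G : rgraph k) : mbf (fun z => (is_graph G z)%:R : R).
Proof.
elim: k G => [|k ih] G; first exact: mbf_cst.
rewrite (_ : (fun z => _) = fun z => (is_graph G.1 z)%:R * (row G.2 k z)%:R).
  by apply: mbfM; [exact: ih|exact: mbf_row].
by apply/funext => z; rewrite /= -mulnb natrM.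
Qed.

Lemma is_graph_vindep k (G : rgraph k) v : (k <= v)%N ->
  vindep v (fun z => (is_graph G z)%:R).
Proof.
move=> kv c z t; congr ((nat_of_bool _)%:R).
elim: k G kv => //= k ih G kv; rewrite ih ?(ltnW kv)//; congr (_ && _).
apply: eq_forallb => i; rewrite adj_upd//= neq_ltn ?kv//.
by rewrite (ltn_trans (ltn_ord i) kv).
Qed.

(** * The law of the graph and its relative entropy *)

Variable z0 : Omega.

(** An average is still a function of the point, so it is evaluated at [z0]; the torus graph takes
    the zero point, as [iint] does. *)
Definition graph_prob k (G : rgraph k) : R := expect k (fun z => (is_graph G z)%:R) z0.

Lemma graph_prob_ge0 k (G : rgraph k) : 0 <= graph_prob G.
Proof. by apply: avgs_ge0 => //; exact: mbf_is_graph. Qed.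

Lemma sum_graph_prob k : \sum_(G : rgraph k) graph_prob G = 1.
Proof.
have := @avgs_sum _ _ _ _ P (allcoords k) _ (index_enum (rgraph k)) _ (@mbf_is_graph k).
move=> /(congr1 (fun f => f z0)) /= <-.
rewrite (_ : (fun z => _) = fun=> 1) ?avgs_cst//.
by apply/funext => z; rewrite sum_is_graph.
Qed.

Lemma graph_probS k (G : rgraph k) (r : {ffun 'I_k -> bool}) :
  graph_prob ((G, r) : rgraph k.+1) = expect k (fun z => (is_graph G z)%:R * cond r z) z0.
Proof.
rewrite /graph_prob expectS; congr (expect k _ _).
rewrite (_ : (fun z => _) = fun z => (is_graph G z)%:R * (row r k z)%:R); last first.
  by apply/funext => z; rewrite /= -mulnb natrM.
rewrite /vavg avgsM_indep//; last exact: mbf_row.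
by apply: vindepP; exact: is_graph_vindep.
Qed.

Lemma cond_bounds k (r : {ffun 'I_k -> bool}) z : 0 <= cond r z <= 1.
Proof.
have mr := mbf_row r k; apply/andP; split.
  by apply: avgs_ge0 => // z'; exact: ler0n.
have := @avgs_le _ _ _ _ P (coords k) _ (fun=> 1) mr (mbf_cst 1); rewrite avgs_cst; apply.
by move=> z'; rewrite lern1 leq_b1.
Qed.

Definition entropy k : R :=
  \sum_(G : rgraph k) graph_prob G * ln (graph_prob G / er_prob G).

Lemma mbf_graph_cond k (G : rgraph k) (r : {ffun 'I_k -> bool}) e :
  mbf (fun z => (is_graph G z)%:R * cond r z ^+ e).
Proof. by apply: mbfM; [exact: mbf_is_graph|apply: mbf_exp; exact: mbf_cond]. Qed.

(** This is what removes the conditioning on the graph already revealed: the right-hand side can be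
    summed over [G]. *)
Lemma graph_prob_cauchy_schwarz k (G : rgraph k) (r : {ffun 'I_k -> bool}) :
  graph_prob ((G, r) : rgraph k.+1) ^+ 2 <=
  graph_prob G * expect k (fun z => (is_graph G z)%:R * cond r z ^+ 2) z0.
Proof.
rewrite graph_probS /graph_prob.
set a := expect k _ z0; set A := expect k _ z0; set B := expect k _ z0.
have mG := mbf_is_graph G; have mc := mbf_cond r.
have m1 : mbf (fun z => (is_graph G z)%:R * cond r z) := mbfM mG mc.
have m2 := mbf_graph_cond G r 2.
(* The mean of [(x - cond r z) ^+ 2] on the event of [G] is nonnegative for every [x]; the choice
   [x = a / A] gives the inequality. *)
have quad (x : R) : 0 <= x ^+ 2 * A + ((-2 * x) * a + B).
  have -> : x ^+ 2 * A + ((-2 * x) * a + B) =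
      expect k (fun z => (is_graph G z)%:R * (x - cond r z) ^+ 2) z0.
    rewrite (_ : (fun z => _ * (x - _) ^+ 2) = fun z => x ^+ 2 * (is_graph G z)%:R +
        ((-2 * x) * ((is_graph G z)%:R * cond r z) +
          (is_graph G z)%:R * cond r z ^+ 2)); last by apply/funext => z; ring.
    have mb : mbf (fun z => (-2 * x) * ((is_graph G z)%:R * cond r z)) by exact: mbfZ.
    have ma : mbf (fun z => x ^+ 2 * (is_graph G z)%:R) by exact: mbfZ.
    rewrite /expect avgsD//; last exact: mbfD.
    by rewrite avgsD// !avgsZ.
  apply: avgs_ge0 => [|z]; last by rewrite mulr_ge0 ?sqr_ge0.
  apply: mbfM => //; apply: mbf_exp.
  rewrite (_ : (fun z => _) = fun z => x + (-1) * cond r z).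
    by apply: mbfD; [exact: mbf_cst|exact: mbfZ].
  by apply/funext => z; rewrite mulN1r.
(* If [A] vanishes then so does [a], which lies between 0 and [A]. *)
have [A0|A0] := eqVneq A 0.
  have B0 : 0 <= B by have := quad 0; rewrite A0; lra.
  suff -> : a = 0 by rewrite A0 expr0n mul0r.
  apply/eqP; rewrite eq_le; apply/andP; split.
    have := @avgs_le _ _ _ _ P (allcoords k) _ _ m1 mG; rewrite -/(expect k _) => h.
    rewrite -A0; apply: h => z; rewrite ler_piMr//.
    by have /andP[] := cond_bounds r z.
  by apply: avgs_ge0 => // z; rewrite mulr_ge0//; have /andP[] := cond_bounds r z.
have Ap : 0 < A by rewrite lt_neqAle eq_sym A0; exact: graph_prob_ge0.
have := quad (a / A).
rewrite -(pmulr_rge0 _ Ap).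
have -> : A * ((a / A) ^+ 2 * A + (-2 * (a / A) * a + B)) = A * B - a ^+ 2.
  by field; rewrite gt_eqF.
by rewrite subr_ge0.
Qed.

(** By [expect_cond_sq], the chi-square divergence of row [k] from independent Bernoulli variables,
    averaged over the earlier positions. *)
Definition chi2 k : R := vavg k (vavg k.+1 (fun z => (1 + corr k k.+1 z) ^+ k)) z0 - 1.

(** [entropy_chain_le] with the Cauchy-Schwarz bound as [B]. The indicators of the graphs [G] sum to
    1, so summing [B] leaves the second moment computed in [expect_cond_sq]. *)
Lemma entropyS k : entropy k.+1 <= entropy k + chi2 k.
Proof.
rewrite {1}/entropy sum_rgraphS.
pose a (G : rgraph k) (r : {ffun 'I_k -> bool}) := graph_prob ((G, r) : rgraph k.+1).
pose B (G : rgraph k) (r : {ffun 'I_k -> bool}) :=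
  expect k (fun z => (is_graph G z)%:R * cond r z ^+ 2) z0.
apply: (le_trans (@entropy_chain_le R _ _ a B (@graph_prob k) (@er_prob k) (@row_prob k)
  _ _ _ _ _ _ _)).
- by move=> *; exact: graph_prob_ge0.
- move=> G r; rewrite /a graph_probS; apply: avgs_le.
  + by apply: mbfM; [exact: mbf_is_graph|exact: mbf_cond].
  + exact: mbf_is_graph.
  + by move=> z; rewrite ler_piMr//; have /andP[] := cond_bounds r z.
- exact: er_prob_gt0.
- exact: row_prob_gt0.
- move=> G; rewrite /a /graph_prob /expect.
  have := @avgs_sum _ _ _ _ P (allcoords k.+1) _ (index_enum {ffun 'I_k -> bool})
    _ (fun r => mbf_is_graph ((G, r) : rgraph k.+1)).
  move=> /(congr1 (fun f => f z0)) /= <-.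
  rewrite (_ : (fun z => _) = fun z => (is_graph G z)%:R); last first.
    apply/funext => z; under eq_bigr do rewrite -mulnb natrM.
    by rewrite -mulr_sumr sum_row mulr1.
  rewrite -/(expect k.+1 _) expectS; congr (expect k _ _).
  transitivity (vavg k (fun z => (is_graph G z)%:R * 1)).
    by congr vavg; apply/funext => z; rewrite mulr1.
  rewrite /vavg avgsM_indep ?avgs_cst//; last exact: mbf_cst.
    by apply/funext => z; rewrite mulr1.
  by apply: vindepP; exact: is_graph_vindep.
- move=> G r; apply: avgs_ge0; first exact: mbf_graph_cond.
  by move=> z; rewrite mulr_ge0 ?sqr_ge0.
- by move=> G r; exact: graph_prob_cauchy_schwarz.
rewrite sum_graph_prob -addrA lerD2l lerD2r.
rewrite -expect_cond_sq exchange_big /=.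
have m2 (r : {ffun 'I_k -> bool}) : mbf (fun z => (row_prob r)^-1 * cond r z ^+ 2).
  by apply: mbfZ; apply: mbf_exp; exact: mbf_cond.
rewrite le_eqVlt; apply/orP; left; apply/eqP.
rewrite /expect avgs_sum//; apply: eq_bigr => r _.
rewrite avgsZ; last by apply: mbf_exp; exact: mbf_cond.
rewrite -mulr_suml mulrC; congr (_ * _); rewrite /B /expect.
have := @avgs_sum _ _ _ _ P (allcoords k) _ (index_enum (rgraph k))
    _ (fun G => mbf_graph_cond G r 2).
move=> /(congr1 (fun f => f z0)) /= <-; congr (avgsP _ _ _).
by apply/funext => z; rewrite -mulr_suml sum_is_graph mul1r.
Qed.

Lemma entropy_le k : entropy k <= \sum_(j < k) chi2 j.
Proof.
elim: k => [|k ih].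
  rewrite big_ord0 /entropy (big_pred1 tt) => [|[]//].
  by rewrite /graph_prob /expect avgs_cst divr1 ln1 mulr0.
by rewrite big_ord_recr /= (le_trans (entropyS k))// lerD2r.
Qed.

(** * Bounding the averaged divergences *)

Lemma mbf_prod_affine u v (al be : R) :
  mbf (fun z => \prod_(c <- iota 0 dim) (al + be * overlapf u v c z)).
Proof.
apply: mbf_prod => c; apply: mbfD; first exact: mbf_cst.
by apply: mbfZ; exact: mbf_overlapf.
Qed.

(** The product averages to [(1 - 2 * lam + lam ^+ 2) ^+ dim], which is [p ^+ 2] since the base is
    [tau ^+ 2]. *)
Lemma vavg2_corr u v : u != v -> vavg u (vavg v (corr u v)) = fun=> 0.
Proof.
move=> uv; pose a := (p * (1 - p))^-1.
have -> : corr u v = fun z => (- p ^+ 2 * a) +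
    a * \prod_(c <- iota 0 dim) ((1 - 2 * lam) + 1 * overlapf u v c z).
  apply/funext => z; rewrite /corr -/a; under [in RHS]eq_bigr do rewrite mul1r.
  by rewrite mulrC mulrDr addrC mulrC.
have mp := mbf_prod_affine u v (1 - 2 * lam) 1.
have mp' := mbfZ a mp.
rewrite /vavg -avgs_cat avgsD//; last exact: mbf_cst.
rewrite avgs_cst avgsZ// avgs_cat -/(vavg v _) -/(vavg u _) vavg2_prod_affine//.
apply/funext => z; have -> : 1 - 2 * lam + 1 * lam ^+ 2 = tau ^+ 2 by ring.
by rewrite exprAC; ring.
Qed.

(** The linear term of the expansion has mean zero. The product in the remainder averages to
    [(1 + 28 / eta * lam ^+ 2) ^+ dim], at most [expR 28] because [dim%:R * lam ^+ 2 <= eta]. *)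
Lemma chi2_le k (eta : R) : 0 <= lam <= 2^-1 -> p <= 2^-1 ->
  0 < eta <= 1 -> k%:R * eta <= 1 -> dim%:R * lam ^+ 2 <= eta -> 28 * lam <= eta ->
  chi2 k <= 256 * k%:R ^+ 2 * p ^+ 2 * eta ^+ 2 * expR 28.
Proof.
move=> l01 p2 e01 ke dl l28; have [e0 e1] := andP e01.
have kk1 : k != k.+1 by rewrite neq_ltn ltnSn.
pose K := 256 * k%:R ^+ 2 * p ^+ 2 * eta ^+ 2.
have K0 : 0 <= K.
  have -> : K = 256 * (k%:R * p * eta) ^+ 2 by rewrite /K; ring.
  by rewrite mulr_ge0 ?sqr_ge0.
pose T z := \prod_(c <- iota 0 dim) (1 + 28 / eta * overlapf k k.+1 c z).
have mT : mbf T := mbf_prod_affine k k.+1 1 (28 / eta).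
have mc := mbf_corr k k.+1.
have pw z : (1 + corr k k.+1 z) ^+ k <= (1 + k%:R * corr k k.+1 z) + K * T z.
  have := @overlap_product_bound R (iota 0 dim) (fun c => overlapf k k.+1 c z) lam eta k.
  rewrite size_iota /= (_ : 1 - lam = tau); last by ring.
  by apply => // [c|]; [exact: overlapf_bounds|rewrite p_gt0].
have m1 : mbf (fun z => (1 + corr k k.+1 z) ^+ k).
  by apply: mbf_exp; apply: mbfD => //; exact: mbf_cst.
have mkc : mbf (fun z => k%:R * corr k k.+1 z) by exact: mbfZ.
have m2 : mbf (fun z => 1 + k%:R * corr k k.+1 z) by apply: mbfD => //; exact: mbf_cst.
have mKT : mbf (fun z => K * T z) by exact: mbfZ.
have avgle : vavg k (vavg k.+1 (fun z => (1 + corr k k.+1 z) ^+ k)) z0 <=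
    vavg k (vavg k.+1 (fun z => (1 + k%:R * corr k k.+1 z) + K * T z)) z0.
  apply: avgs_le; [exact: mbf_avgs|by apply: mbf_avgs; exact: mbfD|].
  by apply: avgs_le => //; exact: mbfD.
rewrite /chi2 lerBlDl (le_trans avgle)//.
have -> : vavg k (vavg k.+1 (fun z => (1 + k%:R * corr k k.+1 z) + K * T z)) =
    fun=> 1 + K * (1 + 28 / eta * lam ^+ 2) ^+ dim.
  rewrite /vavg -avgs_cat avgsD// avgsD//; last exact: mbf_cst.
  rewrite avgs_cst !avgsZ// !avgs_cat -!/(vavg k.+1 _) -!/(vavg k _).
  rewrite vavg2_corr// vavg2_prod_affine//.
  by apply/funext => z; rewrite mulr0 addr0.
rewrite lerD2l; apply: ler_wpM2l => //.
have h : 0 <= 28 / eta * lam ^+ 2 by rewrite mulr_ge0 ?sqr_ge0// divr_ge0// ltW.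
apply: (@le_trans _ _ (expR (28 / eta * lam ^+ 2) ^+ dim)).
  by rewrite lerXn2r ?nnegrE ?expR_ge0 ?expR_ge1Dx// addr_ge0.
rewrite -expRM_natl ler_expR.
have -> : dim%:R * (28 / eta * lam ^+ 2) = 28 * (dim%:R * lam ^+ 2 / eta) by ring.
by rewrite -[leRHS]mulr1 ler_wpM2l// ler_pdivrMr// mul1r.
Qed.

Lemma sum_graph_prob_sub_er_le n (eta c : R) : 0 <= lam <= 2^-1 -> p <= 2^-1 ->
  0 < eta <= 1 -> n%:R * eta <= 1 -> dim%:R * lam ^+ 2 <= eta -> 28 * lam <= eta -> 0 < c ->
  \sum_(G : rgraph n) `|graph_prob G - er_prob G| <=
  c / 2 * (n%:R * (256 * n%:R ^+ 2 * p ^+ 2 * eta ^+ 2 * expR 28)) + 2 / c.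
Proof.
move=> l01 p2 e01 ne dl l28 c0; have [e0 _] := andP e01.
apply: (le_trans (sum_abs_sub_le_entropy (@graph_prob_ge0 n) (@er_prob_gt0 n) c0
  (sum_graph_prob n) (sum_er_prob n))).
rewrite lerD2r; apply: ler_wpM2l; first by rewrite divr_ge0 ?ltW.
apply: (le_trans (entropy_le n)).
apply: (@le_trans _ _ (\sum_(j < n) 256 * n%:R ^+ 2 * p ^+ 2 * eta ^+ 2 * expR 28)).
  apply: ler_sum => j _; have jn : j%:R <= n%:R :> R by rewrite ler_nat ltnW.
  apply: (le_trans (@chi2_le j eta l01 p2 e01 _ dl l28)).
    by apply: le_trans ne; rewrite ler_wpM2r// ltW.
  apply: ler_wpM2r; first exact: expR_ge0.
  apply: ler_wpM2r; first exact: sqr_ge0.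
  apply: ler_wpM2r; first exact: sqr_ge0.
  by apply: ler_wpM2l => //; rewrite lerXn2r ?nnegrE.
by rewrite sumr_const card_ord -[leLHS]mulr_natl.
Qed.

End KernelGraph.

(** * The torus graph *)

Section GraphCode.
Context (R : realType) (dX : measure_display) (X : measurableType dX).
Variables (b : X -> X -> bool) (tau : R) (dim : nat).

(** Only the entries [A i j] with [i < j < k] are read, in the row order of [rgraph]. *)
Fixpoint code k (A : nat -> nat -> bool) : rgraph k :=
  match k with
  | 0 => tt
  | k'.+1 => (code k' A, [ffun i : 'I_k' => A i k'])
  end.

Lemma is_graph_codeP k A z :
  reflect (forall i j, (i < j)%N -> (j < k)%N -> adj b dim i j z = A i j)
          (is_graph b dim (code k A) z).
Proof.
elim: k => [|k ih] /=; first by constructor.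
apply: (iffP andP) => [[/ih h /forallP hr] i j ij|h].
  rewrite ltnS leq_eqVlt => /orP[/eqP jk|jk]; last exact: h.
  by subst j; have := hr (Ordinal ij); rewrite ffunE => /eqP.
split; first by apply/ih => i j ij jk; apply: h => //; exact: leqW.
by apply/forallP => i; rewrite ffunE; apply/eqP; exact: h.
Qed.

Lemma er_prob_code k A :
  er_prob tau dim (code k A) = \prod_(j < k) \prod_(i < k | (i < j)%N) bern tau dim (A i j).
Proof.
have -> : \prod_(j < k) \prod_(i < k | (i < j)%N) bern tau dim (A i j) =
    \prod_(j < k) \prod_(i < j) bern tau dim (A i j).
  apply: eq_bigr => j _.
  by rewrite (big_ord_widen _ (fun i => bern tau dim (A i j)) (ltnW (ltn_ord j))).
elim: k => [|k ih]; first by rewrite big_ord0.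
rewrite big_ord_recr /= -ih; congr (_ * _).
by apply: eq_bigr => i _; rewrite ffunE.
Qed.

Lemma code_inj k A B : code k A = code k B ->
  forall i j, (i < j)%N -> (j < k)%N -> A i j = B i j.
Proof.
elim: k => //= k ih [/ih h /ffunP hr] i j ij.
rewrite ltnS leq_eqVlt => /orP[/eqP jk|jk]; last exact: h.
by subst j; have := hr (Ordinal ij); rewrite !ffunE.
Qed.

End GraphCode.

(** * Edge sets and their row-by-row codes *)

Section EdgeSets.
Local Close Scope classical_set_scope.
Variable n : nat.
Implicit Types (E : graph_on n) (i j : 'I_n).

Definition pairs : graph_on n := [set e : {set 'I_n} | #|e| == 2%N].

(** Indices of [n] or more get the default [false]; [code n] never reads them. *)
Definition edge_rel E (i j : nat) : bool :=
  if (insub i, insub j) is (Some i', Some j') then [set i'; j']%SET \in E else false.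

Lemma edge_relE E i j : edge_rel E i j = ([set i; j]%SET \in E).
Proof. by rewrite /edge_rel !valK. Qed.

Lemma set2_ltn_inj i j i' j' : (i < j)%N -> (i' < j')%N ->
  [set i; j]%SET = [set i'; j']%SET -> (i, j) = (i', j').
Proof.
move=> ij ij' e.
have : i \in [set i'; j'] by rewrite -e set21.
have : j \in [set i'; j'] by rewrite -e set22.
rewrite !inE => /orP[]/eqP jE /orP[]/eqP iE; move: ij ij'; rewrite jE iE ?ltnn//.
by move=> /ltn_trans h /h; rewrite ltnn.
Qed.

Lemma pairs_ltn e : e \in pairs -> exists i j, (i < j)%N /\ e = [set i; j]%SET.
Proof.
rewrite inE => /cards2P[i [j [ij ->]]].
case: (ltngtP i j) => h; first by exists i, j.
- by exists j, i; rewrite finset.setUC.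
- by move: ij; rewrite (val_inj h) eqxx.
Qed.

Lemma set2_pairs i j : (i < j)%N -> [set i; j]%SET \in pairs.
Proof. by move=> ij; rewrite inE cards2 neq_ltn ij. Qed.

Lemma prod_pairs (R : realType) (F : {set 'I_n} -> R) :
  \prod_(e in pairs) F e = \prod_(j < n) \prod_(i < n | (i < j)%N) F [set i; j]%SET.
Proof.
(* Every 2-set has exactly one increasing enumeration; the larger endpoint comes first to match the
   outer index [j]. *)
pose A := [set x : 'I_n * 'I_n | (x.2 < x.1)%N].
have -> : pairs = [set [set x.2; x.1]%SET | x in A].
  apply/setP => e; apply/idP/imsetP => [/pairs_ltn[i [j [ij ->]]]|[x]].
    by exists (j, i) => //; rewrite inE.
  by rewrite inE => xx ->; exact: set2_pairs.
rewrite big_imset /=; last first.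
  move=> [x1 x2] [y1 y2]; rewrite !inE /= => xx yy.
  by move/(set2_ltn_inj xx yy) => -[-> ->].
by rewrite pair_big_dep /=; apply: eq_bigl => x; rewrite inE.
Qed.

Lemma er_law_code (R : realType) (tau : R) dim E : E \subset pairs ->
  er_law (tau ^+ dim) E = er_prob tau dim (code n (edge_rel E)).
Proof.
move=> EU; rewrite /er_law EU er_prob_code.
transitivity (\prod_(e in pairs) bern tau dim (e \in E)); last first.
  by rewrite prod_pairs; apply: eq_bigr => j _; apply: eq_bigr => i _; rewrite edge_relE.
rewrite (bigID (mem E)) /=; congr (_ * _).
  rewrite (eq_bigr (fun=> tau ^+ dim)) => [|e /andP[_ ->]//].
  rewrite prodr_const; congr (_ ^+ _); apply: eq_card => e; rewrite [RHS]unfold_in /=.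
  by case: (boolP (e \in E)) => [eE|_]; rewrite ?andbF// (fintype.subsetP EU e eE).
rewrite (eq_bigr (fun=> 1 - tau ^+ dim)) => [|e /andP[_ /negbTE ->]//].
rewrite prodr_const; congr (_ ^+ _).
have <- : #|pairs| = 'C(n, 2) by rewrite card_draws card_ord.
rewrite -(cardsID E pairs) (finset.setIidPr EU) addKn.
by apply: eq_card => e; rewrite [RHS]unfold_in /= finset.in_setD andbC.
Qed.

Lemma edge_rel_inj E E' : E \subset pairs -> E' \subset pairs ->
  code n (edge_rel E) = code n (edge_rel E') -> E = E'.
Proof.
move=> EU EU' /code_inj h; apply/setP => e.
have [eU|eU] := boolP (e \in pairs).
  by have [i [j [ij ->]]] := pairs_ltn eU; rewrite -!edge_relE h.
by rewrite (negbTE (contra (fintype.subsetP EU e) eU)) (negbTE (contra (fintype.subsetP EU' e) eU)).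
Qed.

End EdgeSets.

(** * The law of the torus graph as a kernel graph *)

Section RggLaw.
Variables (R : realType) (n d : nat) (tau : R).
Hypothesis tau01 : 0 <= tau <= 1.

Local Notation b := (@circle_close R tau).
Local Notation P := (@circle_prob R).

Let measurable_b (dT : measure_display) (T : measurableType dT)
    (f g : T -> measurableTypeR R) :
  measurable_fun setT f -> measurable_fun setT g ->
  measurable_fun setT (fun t => (b (f t) (g t))%:R : R).
Proof. exact: measurable_circle_close. Qed.

(** The maximum defining [linf] starts from 0, whence the sign condition on [t]. *)
Lemma linf_le (m : nat) (x y : 'I_m -> R) (t : R) : 0 <= t ->
  (linf x y <= t) = [forall k, circd (x k) (y k) <= t].
Proof.
move=> t0; rewrite /linf; apply/idP/forallP => [h k|h].
  by apply: le_trans h; exact: le_bigmax.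
by apply/bigmax_leP; split.
Qed.

Lemma linf_adj (i j : nat) (z : nat * nat -> R) :
  (forall c, 0 <= z c < 2) ->
  (linf (fun k : 'I_d => z (i, nat_of_ord k)) (fun k => z (j, nat_of_ord k)) <= tau) =
  adj b d i j z.
Proof.
move=> z02; rewrite linf_le; last by case/andP: tau01.
apply/forallP/allP => [h c|h k].
  rewrite mem_iota add0n => /andP[_ cd].
  by have := h (Ordinal cd); rewrite /circle_close !circle_rep_id.
have := h k; rewrite mem_iota add0n /= ltn_ord => /(_ isT).
by rewrite /circle_close !circle_rep_id.
Qed.

Definition ordpair (m m' : nat) (x : 'I_m * 'I_m') : nat * nat := (nat_of_ord x.1, nat_of_ord x.2).

Lemma ordpair_inj m m' : injective (@ordpair m m').
Proof. by move=> [i k] [i' k'] [/val_inj -> /val_inj ->]. Qed.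

Lemma allcoords_uniq k : uniq (allcoords d k).
Proof.
elim: k => // k ih; rewrite allcoordsS cat_uniq ih coords_uniq andbT /=.
by apply/hasPn => i /mem_coords ik; apply/negP => /mem_allcoords; rewrite ik ltnn.
Qed.

Lemma mem_allcoordsE k (v c : nat) : ((v, c) \in allcoords d k) = (v < k)%N && (c < d)%N.
Proof.
apply/flatten_mapP/andP => [[w]|[vk cd]].
  by rewrite mem_iota add0n /= => wk /mapP[c']; rewrite mem_iota add0n /= => ? [-> ->].
by exists v; rewrite ?mem_iota// map_f// mem_iota.
Qed.

Lemma allcoords_perm k : perm_eq (allcoords d k) (map (@ordpair k d) (enum {: 'I_k * 'I_d})).
Proof.
apply: uniq_perm; [exact: allcoords_uniq|by rewrite map_inj_uniq ?enum_uniq//; exact: ordpair_inj|].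
move=> [v c]; rewrite mem_allcoordsE; apply/andP/mapP => [[vk cd]|[[i j] _ [-> ->]]].
  by exists (Ordinal vk, Ordinal cd) => //; rewrite mem_enum.
by split.
Qed.

(** The two random points become vertices 0 and 1; averaging over vertex 1 alone already gives the
    constant [tau ^+ d]. *)
Lemma edge_probE : edge_prob d tau = tau ^+ d.
Proof.
pose phi (x : bool * 'I_d) : nat * nat := (nat_of_bool x.1, nat_of_ord x.2).
have phi_inj : injective phi by move=> [[] k] [[] k'] // [/val_inj ->].
rewrite /edge_prob (@unif_prob_avgs R _ _ phi (allcoords d 2) (adj b d 0 1)) => //.
- have := @expectS R _ _ P d 1 (fun z => (adj b d 0 1 z)%:R).
  rewrite /expect => ->.
  rewrite (vavg_adj (tau := tau))//; first by rewrite avgs_cst.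
  by move=> x; exact: circle_close_marginal.
- apply: uniq_perm; [exact: allcoords_uniq|by rewrite map_inj_uniq ?enum_uniq|].
  move=> [v c]; rewrite mem_allcoordsE; apply/andP/mapP => [[v2 cd]|[[e k] _ [-> ->]]].
    exists (v == 1%N, Ordinal cd); first by rewrite mem_enum.
    by case: v v2 => [|[|]].
  by split=> //; case: e.
- exact: mbf_adj.
- by move=> z z02; exact: linf_adj.
Qed.

Lemma rgg_law_notin (E : graph_on n) : ~~ (E \subset pairs n) -> rgg_law d tau E = 0.
Proof.
move=> EU; rewrite /rgg_law.
rewrite (@unif_prob_avgs R _ _ (@ordpair n d) (allcoords d n) (fun=> false)) => //.
- by rewrite avgs_cst.
- exact: ordpair_inj.
- exact: allcoords_perm.
- exact: mbf_cst.
- move=> z z02; apply/negbTE/negP => /eqP Ez; move/negP: EU; apply; rewrite -Ez.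
  apply/fintype.subsetP => e; rewrite inE => /existsP[i /existsP[j /and3P[ij /eqP -> _]]].
  exact: set2_pairs.
Qed.

Lemma rgg_law_code (E : graph_on n) : E \subset pairs n ->
  rgg_law d tau E = graph_prob P b d (fun=> 0) (code n (edge_rel E)).
Proof.
move=> EU; rewrite /rgg_law.
rewrite (@unif_prob_avgs R _ _ (@ordpair n d) (allcoords d n)
  (is_graph b d (code n (edge_rel E)))) => //.
- exact: ordpair_inj.
- exact: allcoords_perm.
- exact: mbf_is_graph.
- move=> z z02.
  have memE (i j : 'I_n) : (i < j)%N ->
      ([set i; j]%SET \in rgg_graph tau (z \o @ordpair n d)) = adj b d i j z.
    move=> ij; rewrite inE -linf_adj//; apply/existsP/idP => [[i' /existsP[j']]|h].
      by move=> /and3P[ij' /eqP /(set2_ltn_inj ij ij') [-> ->]].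
    by exists i; apply/existsP; exists j; rewrite ij eqxx.
  apply/eqP/is_graph_codeP => [Ez i j ij jn|h].
    have iN := ltn_trans ij jn.
    by rewrite -(memE (Ordinal iN) (Ordinal jn) ij) Ez (edge_relE E (Ordinal iN) (Ordinal jn)).
  apply/setP => e; have [eU|eU] := boolP (e \in pairs n).
    by have [i [j [ij ->]]] := pairs_ltn eU; rewrite memE// h// edge_relE.
  rewrite (negbTE (contra (fintype.subsetP EU e) eU)); apply/negbTE; apply: contra eU.
  rewrite inE => /existsP[i /existsP[j /and3P[ij /eqP -> _]]].
  exact: set2_pairs.
Qed.

(** Edge sets containing something other than pairs have mass 0 under both laws. The others inject
    into [rgraph n], so their sum is at most the sum over all codes, and the factor 1/2 is bounded
    by 1. *)
Lemma tv_rgg_er_le :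
  tv_rgg_er n d (tau ^+ d) tau <=
  \sum_(G : rgraph n) `|graph_prob P b d (fun=> 0) G - er_prob tau d G|.
Proof.
pose F (G : rgraph n) := `|graph_prob P b d (fun=> 0) G - er_prob tau d G|.
rewrite -[leRHS]/(\sum_G F G).
pose A : {set graph_on n} := [set E : graph_on n | E \subset pairs n]%SET.
have F0 G : 0 <= F G by rewrite /F.
have sumE : \sum_(E : graph_on n) `|rgg_law d tau E - er_law (tau ^+ d) E| =
    \sum_(E in A) F (code n (edge_rel E)).
  rewrite (bigID (mem A)) /= [X in _ + X]big1 ?addr0 => [|E].
    by apply: eq_bigr => E; rewrite inE => EU; rewrite /F rgg_law_code// er_law_code.
  by rewrite inE => EU; rewrite rgg_law_notin// /er_law (negbTE EU) subr0 normr0.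
rewrite /tv_rgg_er sumE.
rewrite -(big_imset (h := fun E => code n (edge_rel E)) F) /=; last first.
  by move=> E E'; rewrite !inE; exact: edge_rel_inj.
have S0 : 0 <= \sum_(G in [set code n (edge_rel E) | E in A]%SET) F G by exact: sumr_ge0.
apply: (@le_trans _ _ (\sum_(G in [set code n (edge_rel E) | E in A]%SET) F G)).
  by rewrite ler_piMl// invf_le1// ler1n.
by rewrite [leRHS](bigID (mem [set code n (edge_rel E) | E in A]%SET)) /= lerDl sumr_ge0.
Qed.

End RggLaw.

(** * Asymptotics *)

Section Asymptotics.
Variable R : realType.

Lemma edge_prob_lt0 (d : nat) (tau : R) : tau < 0 -> edge_prob d tau = 0.
Proof.
move=> t0; rewrite /edge_prob /unif_prob.
rewrite (@eq_iint _ _ _ _ (fun=> 0%:E)) => [|z _].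
  by rewrite (iint_avgs (f := fun=> 0)) ?enum_uniq// ?avgs_cst//; exact: mbf_cst.
rewrite (_ : (_ <= tau) = false)//; apply/negbTE; rewrite -ltNge (lt_le_trans t0)//.
by rewrite /linf; exact: bigmax_ge_id.
Qed.

Lemma edge_prob_gt1 (d : nat) (tau : R) : 1 < tau -> edge_prob d tau = 1.
Proof.
move=> t1; rewrite /edge_prob /unif_prob.
rewrite (@eq_iint _ _ _ _ (fun=> 1%:E)) => [|z _].
  by rewrite (iint_avgs (f := fun=> 1)) ?enum_uniq// ?avgs_cst//; exact: mbf_cst.
rewrite linf_le; last by lra.
rewrite (_ : [forall k, _])//; apply/forallP => k; apply: le_trans (ltW t1).
by rewrite /circd ge_min; case: (lerP `|z (false, k) - z (true, k)| 1) => //= h; lra.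
Qed.

(** A threshold outside the unit interval would make the edge probability 0 or 1, which the range of
    [p] excludes. *)
Lemma edge_prob_inv (d : nat) (tau p : R) : edge_prob d tau = p -> 0 < p <= 2^-1 ->
  0 <= tau <= 1 /\ tau ^+ d = p.
Proof.
move=> <- /andP[p0 p1]; have t01 : 0 <= tau <= 1.
  apply/andP; split; rewrite leNgt; apply/negP => h.
    by move: p0; rewrite edge_prob_lt0// ltxx.
  by move: p1; rewrite edge_prob_gt1//; lra.
by split=> //; rewrite edge_probE.
Qed.

(** The entropy bound with [eta = L ^+ 2 / d%:R] and Pinsker parameter [c = M]: the two assumptions
    on [d] give [n%:R * eta <= 1] and [M * Y <= 1]. *)
Lemma tv_rgg_er_bound (n d : nat) (p tau M : R) :
  expR 28 <= n%:R :> R -> n%:R^-1 <= p <= 2^-1 -> edge_prob d tau = p -> 1 <= M ->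
  M * n%:R * ln (n%:R : R) ^+ 2 <= d%:R ->
  M * (n%:R `^ (3 / 2) * p) * ln (n%:R : R) ^+ 2 <= d%:R ->
  tv_rgg_er n d p tau <= (128 * expR 28 + 2) / M.
Proof.
move=> n_ge /andP[p_ge p2] ep M1 dn dnp.
have n0 : 0 < n%:R :> R by apply: lt_le_trans n_ge; exact: expR_gt0.
have p0 : 0 < p by apply: lt_le_trans p_ge; rewrite invr_gt0.
have M0 : 0 < M by lra.
have [t01 tp] : 0 <= tau <= 1 /\ tau ^+ d = p by apply: edge_prob_inv; rewrite ?p0.
pose L := ln (n%:R : R).
(* This is the reason for [expR 28 <= n%:R]: together with [dlam] it yields
   [28 * (1 - tau) <= eta]. *)
have L28 : 28 <= L by rewrite -[leLHS]expRK ler_ln ?posrE ?expR_gt0.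
have L0 : 0 < ln (n%:R : R) by apply: lt_le_trans L28.
have n1 : 1 <= n%:R :> R by rewrite ler1n -(ltr0n R).
have d0 : 0 < d%:R :> R.
  by apply: lt_le_trans dn; rewrite mulr_gt0 ?exprn_gt0 ?mulr_gt0.
have tau0 : 0 < tau.
  rewrite lt_neqAle; case/andP: t01 => -> _; rewrite andbT; apply/eqP => t0.
  by move: p0; rewrite -tp -t0 expr0n; case: (d) d0 => [|m _]; rewrite ?ltxx.
(* From [p = tau ^+ d], [ln tau <= tau - 1] and [p >= 1 / n]. *)
have dlam : d%:R * (1 - tau) <= L.
  have : ln p = d%:R * ln tau by rewrite -tp lnXn// mulr_natl.
  have : - L <= ln p by rewrite -lnV ?posrE// ler_ln ?posrE// invr_gt0.
  have : d%:R * ln tau <= d%:R * (tau - 1) by rewrite ler_wpM2l ?ln_le_subr1// ltW.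
  by lra.
pose eta := L ^+ 2 / d%:R.
have eta0 : 0 < eta by rewrite divr_gt0// exprn_gt0//; lra.
have etad : eta * d%:R = L ^+ 2 by rewrite /eta divfK// gt_eqF.
have Mneta : M * n%:R * eta <= 1 by rewrite /eta mulrA ler_pdivrMr// mul1r.
have neta : n%:R * eta <= 1.
  apply: le_trans Mneta; rewrite -mulrA ler_peMl// mulr_ge0// ?ltW//.
have eta1 : eta <= 1 by apply: le_trans neta; rewrite ler_peMl// ltW.
have lam0 : 0 <= 1 - tau by case/andP: t01 => _; lra.
have l28 : 28 * (1 - tau) <= eta.
  rewrite /eta ler_pdivlMr// -mulrA [_ * d%:R]mulrC expr2.
  by apply: ler_pM => //; rewrite mulr_ge0// ltW.
have dl2 : d%:R * (1 - tau) ^+ 2 <= eta.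
  rewrite /eta ler_pdivlMr//.
  have -> : d%:R * (1 - tau) ^+ 2 * d%:R = (d%:R * (1 - tau)) ^+ 2 by ring.
  by rewrite lerXn2r ?nnegrE// ?mulr_ge0// ?ltW//; lra.
(* [Y ^+ 2] is the order of the total entropy, and [M * Y ^+ 2 <= 1 / M] follows from
   [M * Y <= 1]. *)
pose Y := n%:R `^ (3 / 2) * p * eta.
have MY : M * Y <= 1.
  have -> : M * Y = M * (n%:R `^ (3 / 2) * p) * L ^+ 2 / d%:R by rewrite /Y /eta; ring.
  by rewrite ler_pdivrMr// mul1r.
have Y0 : 0 <= Y by rewrite !mulr_ge0// ?powR_ge0 ?ltW.
have Y2 : Y ^+ 2 = n%:R * (n%:R ^+ 2 * p ^+ 2 * eta ^+ 2).
  rewrite /Y !exprMn.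
  have -> : (n%:R `^ (3 / 2) : R) ^+ 2 = n%:R ^+ 3.
    by rewrite -powR_mulrn ?powR_ge0// -powRrM divfK// powR_mulrn// ltW.
  by ring.
rewrite -tp; apply: (le_trans (tv_rgg_er_le n d t01)).
apply: (le_trans
  (@sum_graph_prob_sub_er_le R _ _ _ _ tau d _ _ _ _ _ _ n eta M _ _ _ _ _ _ _)) => //.
- by move=> x y; rewrite circle_closeC.
- by move=> *; exact: measurable_circle_close.
- by move=> x; exact: circle_close_marginal.
- by rewrite tp.
- by rewrite tp; lra.
- by rewrite lam0 /=; lra.
- by rewrite tp.
- by rewrite eta0.
rewrite tp.
have -> : M / 2 * (n%:R * (256 * n%:R ^+ 2 * p ^+ 2 * eta ^+ 2 * expR 28)) =
    128 * expR 28 * (M * Y ^+ 2) by rewrite Y2; field.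
rewrite [leRHS]mulrDl lerD2r; apply: ler_wpM2l; first by rewrite mulr_ge0 ?expR_ge0.
rewrite -(ler_pM2r M0) mulVf ?gt_eqF//.
have -> : M * Y ^+ 2 * M = (M * Y) ^+ 2 by ring.
by rewrite expr_le1 // mulr_ge0 // ltW.
Qed.

End Asymptotics.

Unset Implicit Arguments.

Theorem theorem1p2 (R : realType) (delta eps : R) :
  0 < delta -> 0 < eps ->
  exists C : R, 0 <= C /\
  forall (p : nat -> R) (d : nat -> nat) (tau : nat -> R),
    (* Assumption (A) *)
    (\forall n \near \oo,
        (n%:R `^ (eps - 1) <= p n) /\ (p n <= 2^-1) /\ (n%:R `^ delta <= (d n)%:R)) ->
    (* tau n = tau^oo_p for the parameters (n, d n, p n) *)
    (\forall n \near \oo, edge_prob (d n) (tau n) = p n) ->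
    (* d = omega~( max(n^{3/2} p, n) ), polylog factor (ln n)^C *)
    (forall M : R, \forall n \near \oo,
        M <= (d n)%:R /
             (Num.max (n%:R `^ (3 / 2) * p n) n%:R * (ln (n%:R : R)) `^ C)) ->
    (fun n => tv_rgg_er n (d n) (p n) (tau n)) @ \oo --> (0 : R).
Proof.
move=> _ eps0; exists 2; split=> // p d tau hA htau hd.
apply/cvgrPdist_le => e e0.
pose K : R := 128 * expR 28 + 2.
have K0 : 0 < K by rewrite addr_gt0// mulr_gt0// expR_gt0.
(* Chosen so that [K / M <= e]; the added 1 ensures [1 <= M]. *)
pose M := K / e + 1.
have M1 : 1 <= M by rewrite lerDr divr_ge0// ltW.
near=> n.
have n_ge : expR 28 <= n%:R :> R by near: n; exact: nbhs_infty_ger.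
have n0 : 0 < n%:R :> R by apply: lt_le_trans n_ge; exact: expR_gt0.
have n1 : 1 <= n%:R :> R by rewrite ler1n -(ltr0n R).
have [p_ge [p2 _]] : (n%:R `^ (eps - 1) <= p n) /\ (p n <= 2^-1) /\ (n%:R `^ delta <= (d n)%:R).
  by near: n.
have pn : n%:R^-1 <= p n.
  (* As [eps] is positive, [n^(eps - 1)] is at least [1 / n]. *)
  apply: le_trans p_ge; by rewrite -(powR_inv1 (ltW n0)) ler_powR//; lra.
have L0 : 0 < ln (n%:R : R).
  by apply: (@lt_le_trans _ _ 28) => //; rewrite -[leLHS]expRK ler_ln ?posrE ?expR_gt0.
have hdn : M <= (d n)%:R /
    (Num.max (n%:R `^ (3 / 2) * p n) n%:R * (ln (n%:R : R)) `^ 2) by near: n; exact: hd.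
rewrite (powR_mulrn 2 (ltW L0)) ler_pdivlMr in hdn; last first.
  by rewrite mulr_gt0 ?exprn_gt0// lt_max n0 orbT.
have tv0 : 0 <= tv_rgg_er n (d n) (p n) (tau n).
  by rewrite mulr_ge0// sumr_ge0.
rewrite sub0r normrN ger0_norm//.
apply: (@le_trans _ _ (K / M)).
  apply: tv_rgg_er_bound => //.
  - by rewrite pn.
  - by near: n.
  - apply: le_trans hdn; rewrite -mulrA ler_wpM2l ?(le_trans ler01 M1)// ler_wpM2r ?sqr_ge0//.
    by rewrite le_max lexx orbT.
  - apply: le_trans hdn; rewrite -mulrA ler_wpM2l ?(le_trans ler01 M1)// ler_wpM2r ?sqr_ge0//.
    by rewrite le_max lexx.
rewrite ler_pdivrMr ?(lt_le_trans ltr01 M1)// /M mulrDr mulr1 mulrC divfK ?gt_eqF//.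
by rewrite lerDl ltW.
Unshelve. all: by end_near.
Qed.
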